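(* Let $(M,g)$ be an $m$-dimensional submanifold of a space form $(N,h)$ admitting a concircular vector field $\xi$ with nonzero (i.e. nowhere vanishing) concircular function $f$. Assume that $m>2$. If $(M,g)$ is a generalized $\xi$-parallel submanifold, then it is a CMC pseudo-umbilical biharmonic submanifold. Moreover, if the sectional curvature of $(N,h)$ is non-positive, then $(M,g)$ is minimal.
   Context: Manifolds are connected. A space form is a Riemannian manifold of constant sectional curvature. $\mathbf{i}:(M,g)\hookrightarrow(N,h)$ is the inclusion and $g=\mathbf{i}^*h$ is the induced metric; $\nabla^M,\nabla^N$ are the Levi-Civita connections. $B$ is the second fundamental form of $M$ and $H=\frac1m\operatorname{Tr}B$ is its mean curvature vector field; $A_H$ is the shape operator in the direction $H$, $g(A_HX,Y)=h(B(X,Y),H)$. The submanifold is minimal if $H=0$, CMC if $|H|$ is constant, and pseudo-umbilical if $A_H=|H|^2I$, where $I$ is the identity $(1,1)$-tensor field on $M$. A vector field $\xi$ on $N$ is concircular with concircular function $f\in C^\infty(N)$ if $\nabla^N_X\xi=fX$ for all $X\in\Gamma(TN)$. For a smooth map $\varphi:(M,g)\to(N,h)$, let $\nabla^\varphi$ be the pullback connection on $\varphi^{-1}TN$, $R^N(X,Y)Z=\nabla^N_X\nabla^N_YZ-\nabla^N_Y\nabla^N_XZ-\nabla^N_{[X,Y]}Z$, and $\operatorname{Tr}(\nabla^\varphi)^2V=\sum_i(\nabla^\varphi_{e_i}\nabla^\varphi_{e_i}V-\nabla^\varphi_{\nabla^M_{e_i}e_i}V)$ for any local orthonormal frame $\{e_i\}$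 on $M$. The $\xi$-tension field is $$\tau_\xi(\varphi)=\sum_iR^N\big(\xi\circ\varphi,\sigma(d\varphi(e_i))\big)d\varphi(e_i)+\sigma^*\big(\operatorname{Tr}(\nabla^\varphi)^2(\xi\circ\varphi)\big),$$ where $\sigma(X)=\nabla^N_X\xi$ and $\sigma^*$ is its pointwise adjoint with respect to $h$. The submanifold $(M,g)$ is generalized $\xi$-parallel if $\tau_\xi(\mathbf{i})=0$. The submanifold is biharmonic if $\mathbf{i}$ is a biharmonic map, i.e. $\sum_iR^N(\tau(\mathbf{i}),d\mathbf{i}(e_i))d\mathbf{i}(e_i)+\operatorname{Tr}(\nabla^{\mathbf{i}})^2\tau(\mathbf{i})=0$, where $\tau(\mathbf{i})=\operatorname{Tr}\nabla d\mathbf{i}=mH$ is the tension field. *)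

(* Defs.v *)
From HB Require Import structures.
From mathcomp Require Import all_boot all_order all_algebra.
From mathcomp Require Import all_classical all_reals all_analysis.

Set Implicit Arguments.
Unset Strict Implicit.
Unset Printing Implicit Defensive.

Import Order.TTheory GRing.Theory Num.Theory.
Import numFieldNormedType.Exports.

Local Open Scope classical_set_scope.
Local Open Scope ring_scope.

(** Smooth manifolds given by an atlas, with tensor fields given by their
    components in the charts of the atlas.  A tangent vector, resp. a vector
    field, read in a chart is a row vector, resp. a function into row vectors,
    so the differential of f acts on the right by [jacobian f]. *)

(** * Smooth maps between coordinate spaces *)

(* [D] is meant to be open. *)
Fixpoint is_Ck (R : realType) (n : nat) (W : normedModType R) (k : nat)
    (D : set 'rV[R]_n) (f : 'rV[R]_n -> W) : Prop :=
  match k with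
  | 0%N => forall x, D x -> {for x, continuous f}
  | k'.+1 => (forall x, D x -> differentiable f x) /\
             (forall v : 'rV[R]_n, is_Ck k' D (fun x => 'D_v f x))
  end.

Definition smooth_on (R : realType) (n : nat) (W : normedModType R)
    (D : set 'rV[R]_n) (f : 'rV[R]_n -> W) : Prop :=
  forall k, is_Ck k D f.

(** * Manifolds *)

(* [cmap] and [cinv] are total functions; only their values on [cdom] and on
   its image are meaningful. *)
Record chart (R : realType) (T : topologicalType) (n : nat) := Chart {
  cdom : set T;
  cmap : T -> 'rV[R]_n;
  cinv : 'rV[R]_n -> T;
  cdom_open : open cdom;
  cran_open : open (cmap @` cdom);
  cmapK : forall p, cdom p -> cinv (cmap p) = p;
  cmap_continuous : forall p, cdom p -> {for p, continuous cmap};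
  cinv_continuous : forall y, (cmap @` cdom) y -> {for y, continuous cinv}
}.

Definition cran (R : realType) (T : topologicalType) (n : nat)
    (c : chart R T n) : set 'rV[R]_n :=
  cmap c @` cdom c.

Definition transition (R : realType) (T : topologicalType) (n : nat)
    (c d : chart R T n) : 'rV[R]_n -> 'rV[R]_n :=
  cmap d \o cinv c.

Record manifold (R : realType) (n : nat) := Manifold {
  points :> topologicalType;
  atlas : set (chart R points n);
  points_hausdorff : hausdorff_space points;
  points_second_countable : @second_countable points;
  points_connected : connected [set: points];
  atlas_cover : forall p : points, exists2 c, atlas c & cdom c p;
  atlas_compatible : forall c d, atlas c -> atlas d ->
    smooth_on (cmap c @` (cdom c `&` cdom d)) (transition c d)
}.

Definition chart_at (R : realType) (n : nat) (M : manifold R n) (p : M)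
    (c : chart R M n) : Prop :=
  atlas c /\ cdom c p.

Definition smooth_function (R : realType) (n : nat) (M : manifold R n)
    (f : M -> R) : Prop :=
  forall c, @atlas _ _ M c -> smooth_on (cran c) (f \o cinv c : 'rV[R]_n -> R).

Record vector_field (R : realType) (n : nat) (M : manifold R n) := VectorField {
  vf_comp :> chart R M n -> 'rV[R]_n -> 'rV[R]_n;
  vf_smooth : forall c, atlas c -> smooth_on (cran c) (vf_comp c);
  vf_transition : forall (p : M) c d, chart_at p c -> chart_at p d ->
    vf_comp d (cmap d p) =
    vf_comp c (cmap c p) *m jacobian (transition c d) (cmap c p)
}.

(** * Riemannian metrics *)

(* The inner product with Gram matrix [G]. *)
Definition inner (R : realType) (n : nat) (G : 'M[R]_n) (a b : 'rV[R]_n) : R :=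
  (a *m G *m b^T) 0 0.

Record riemannian (R : realType) (n : nat) := Riemannian {
  rman :> manifold R n;
  metric : chart R rman n -> 'rV[R]_n -> 'M[R]_n;
  metric_smooth : forall c, atlas c -> smooth_on (cran c) (metric c);
  metric_sym : forall c, atlas c -> forall y, cran c y ->
    (metric c y)^T = metric c y;
  metric_pos : forall c, atlas c -> forall y, cran c y ->
    forall v : 'rV[R]_n, v != 0 -> 0 < inner (metric c y) v v;
  metric_transition : forall (p : rman) c d, chart_at p c -> chart_at p d ->
    let J := jacobian (transition c d) (cmap c p) in
    metric c (cmap c p) = J *m metric d (cmap d p) *m J^T
}.

(** * Local Riemannian geometry in a chart

    Here [g] and [h] are the Gram matrices of metrics on (open subsets of)
    coordinate spaces, and [phi] is the coordinate expression of a map. *)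

(* The vector representing the linear form [l] for the inner product [G]. *)
Definition sharp (R : realType) (n : nat) (G : 'M[R]_n) (l : 'rV[R]_n -> R) :
    'rV[R]_n :=
  (\row_j l (delta_mx 0 j)) *m invmx G.

Lemma sharpP (R : realType) (n : nat) (G : 'M[R]_n) (l : {linear 'rV[R]_n -> R}) :
  G \in unitmx -> forall w, inner G (sharp G l) w = l w.
Proof.
move=> Gu w; rewrite /inner /sharp mulmxKV // [in RHS](row_sum_delta w).
rewrite linear_sum mxE; apply: eq_bigr => j _.
by rewrite linearZ !mxE /= mulrC.
Qed.

Definition lie (R : realType) (n : nat) (X Y : 'rV[R]_n -> 'rV[R]_n) :
    'rV[R]_n -> 'rV[R]_n :=
  fun y => 'D_(X y) Y y - 'D_(Y y) X y.

(* The Christoffel symbols of the Levi-Civita connection, by the Koszul formula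
   for vector fields with constant components (whose brackets vanish). *)
Definition christoffel (R : realType) (n : nat) (h : 'rV[R]_n -> 'M[R]_n)
    (y a b : 'rV[R]_n) : 'rV[R]_n :=
  sharp (h y) (fun w =>
    2^-1 * ('D_a (fun z => inner (h z) b w) y
          + 'D_b (fun z => inner (h z) a w) y
          - 'D_w (fun z => inner (h z) a b) y)).

Definition nabla (R : realType) (n : nat) (h : 'rV[R]_n -> 'M[R]_n)
    (X Y : 'rV[R]_n -> 'rV[R]_n) : 'rV[R]_n -> 'rV[R]_n :=
  fun y => 'D_(X y) Y y + christoffel h y (X y) (Y y).

Definition curvature (R : realType) (n : nat) (h : 'rV[R]_n -> 'M[R]_n)
    (X Y Z : 'rV[R]_n -> 'rV[R]_n) : 'rV[R]_n -> 'rV[R]_n :=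
  fun y => nabla h X (nabla h Y Z) y - nabla h Y (nabla h X Z) y
           - nabla h (lie X Y) Z y.

(* Tensors are evaluated on vectors at a point by extending the vectors to
   vector fields with constant components. *)
Definition curvature_at (R : realType) (n : nat) (h : 'rV[R]_n -> 'M[R]_n)
    (y a b c : 'rV[R]_n) : 'rV[R]_n :=
  curvature h (fun=> a) (fun=> b) (fun=> c) y.

(* The sectional curvature of the plane spanned by [a] and [b]. *)
Definition sectional (R : realType) (n : nat) (h : 'rV[R]_n -> 'M[R]_n)
    (y a b : 'rV[R]_n) : R :=
  inner (h y) (curvature_at h y a b b) a
  / (inner (h y) a a * inner (h y) b b - inner (h y) a b ^+ 2).

(* The connection induced on [phi^-1 TN], acting on sections [V] along [phi]. *)
Definition nabla_along (R : realType) (m n : nat) (h : 'rV[R]_n -> 'M[R]_n)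
    (phi : 'rV[R]_m -> 'rV[R]_n) (X : 'rV[R]_m -> 'rV[R]_m)
    (V : 'rV[R]_m -> 'rV[R]_n) : 'rV[R]_m -> 'rV[R]_n :=
  fun u => 'D_(X u) V u + christoffel h (phi u) ('d phi u (X u)) (V u).

Definition orthonormal_frame (R : realType) (m : nat) (g : 'rV[R]_m -> 'M[R]_m)
    (W : set 'rV[R]_m) (E : 'I_m -> 'rV[R]_m -> 'rV[R]_m) : Prop :=
  [/\ open W,
      forall i, smooth_on W (E i) &
      forall u, W u -> forall i j, inner (g u) (E i u) (E j u) = (i == j)%:R].

(* [Tr (nabla^phi)^2 V], computed in the frame [E]. *)
Definition trace_nabla2 (R : realType) (m n : nat) (g : 'rV[R]_m -> 'M[R]_m)
    (h : 'rV[R]_n -> 'M[R]_n) (phi : 'rV[R]_m -> 'rV[R]_n)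
    (E : 'I_m -> 'rV[R]_m -> 'rV[R]_m) (V : 'rV[R]_m -> 'rV[R]_n)
    (u : 'rV[R]_m) : 'rV[R]_n :=
  \sum_(i < m) (nabla_along h phi (E i) (nabla_along h phi (E i) V) u
                - nabla_along h phi (nabla g (E i) (E i)) V u).

Definition sigma (R : realType) (n : nat) (h : 'rV[R]_n -> 'M[R]_n)
    (xi : 'rV[R]_n -> 'rV[R]_n) (y a : 'rV[R]_n) : 'rV[R]_n :=
  nabla h (fun=> a) xi y.

Definition sigma_adjoint (R : realType) (n : nat) (h : 'rV[R]_n -> 'M[R]_n)
    (xi : 'rV[R]_n -> 'rV[R]_n) (y v : 'rV[R]_n) : 'rV[R]_n :=
  sharp (h y) (fun a => inner (h y) v (sigma h xi y a)).

Definition xi_tension (R : realType) (m n : nat) (g : 'rV[R]_m -> 'M[R]_m)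
    (h : 'rV[R]_n -> 'M[R]_n) (phi : 'rV[R]_m -> 'rV[R]_n)
    (xi : 'rV[R]_n -> 'rV[R]_n) (E : 'I_m -> 'rV[R]_m -> 'rV[R]_m)
    (u : 'rV[R]_m) : 'rV[R]_n :=
  \sum_(i < m) curvature_at h (phi u) (xi (phi u))
                 (sigma h xi (phi u) ('d phi u (E i u))) ('d phi u (E i u))
  + sigma_adjoint h xi (phi u) (trace_nabla2 g h phi E (xi \o phi) u).

(* [nabla d phi], which for an isometric immersion is the second fundamental
   form, by the Gauss formula. *)
Definition second_form (R : realType) (m n : nat) (g : 'rV[R]_m -> 'M[R]_m)
    (h : 'rV[R]_n -> 'M[R]_n) (phi : 'rV[R]_m -> 'rV[R]_n)
    (u a b : 'rV[R]_m) : 'rV[R]_n :=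
  nabla_along h phi (fun=> a) (fun z => 'd phi z b) u
  - 'd phi u (nabla g (fun=> a) (fun=> b) u).

(* The trace of the bilinear map [T] with respect to the inner product [G]. *)
Definition metric_trace (R : realType) (m n : nat) (G : 'M[R]_m)
    (T : 'rV[R]_m -> 'rV[R]_m -> 'rV[R]_n) : 'rV[R]_n :=
  \sum_(i < m) \sum_(j < m)
    invmx G i j *: T (delta_mx 0 i) (delta_mx 0 j).

Definition tension (R : realType) (m n : nat) (g : 'rV[R]_m -> 'M[R]_m)
    (h : 'rV[R]_n -> 'M[R]_n) (phi : 'rV[R]_m -> 'rV[R]_n) (u : 'rV[R]_m) :
    'rV[R]_n :=
  metric_trace (g u) (second_form g h phi u).

Definition mean_curvature (R : realType) (m n : nat) (g : 'rV[R]_m -> 'M[R]_m)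
    (h : 'rV[R]_n -> 'M[R]_n) (phi : 'rV[R]_m -> 'rV[R]_n) (u : 'rV[R]_m) :
    'rV[R]_n :=
  m%:R^-1 *: metric_trace (g u) (second_form g h phi u).

(* The shape operator in the direction [eta], a normal vector at [phi u]. *)
Definition shape_operator (R : realType) (m n : nat) (g : 'rV[R]_m -> 'M[R]_m)
    (h : 'rV[R]_n -> 'M[R]_n) (phi : 'rV[R]_m -> 'rV[R]_n)
    (u : 'rV[R]_m) (eta : 'rV[R]_n) (a : 'rV[R]_m) : 'rV[R]_m :=
  sharp (g u) (fun b => inner (h (phi u)) (second_form g h phi u a b) eta).

Definition bitension (R : realType) (m n : nat) (g : 'rV[R]_m -> 'M[R]_m)
    (h : 'rV[R]_n -> 'M[R]_n) (phi : 'rV[R]_m -> 'rV[R]_n)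
    (E : 'I_m -> 'rV[R]_m -> 'rV[R]_m) (u : 'rV[R]_m) : 'rV[R]_n :=
  \sum_(i < m) curvature_at h (phi u) (tension g h phi u)
                 ('d phi u (E i u)) ('d phi u (E i u))
  + trace_nabla2 g h phi E (tension g h phi) u.

(** * Properties of Riemannian manifolds and of their submanifolds *)

Definition space_form (R : realType) (n : nat) (N : riemannian R n) : Prop :=
  exists kappa : R, forall (q : N) d, chart_at q d ->
    forall a b : 'rV[R]_n, row_free (col_mx a b) ->
    sectional (metric d) (cmap d q) a b = kappa.

Definition nonpositive_sectional (R : realType) (n : nat) (N : riemannian R n) :
    Prop :=
  forall (q : N) d, chart_at q d ->
    forall a b : 'rV[R]_n, row_free (col_mx a b) ->
    sectional (metric d) (cmap d q) a b <= 0.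

(* By locality of the connection, [X] ranges over the vector fields on the
   domain of a chart. *)
Definition concircular (R : realType) (n : nat) (N : riemannian R n)
    (xi : vector_field N) (f : N -> R) : Prop :=
  smooth_function f /\
  forall (d : chart R N n) (X : 'rV[R]_n -> 'rV[R]_n),
    atlas d -> smooth_on (cran d) X ->
    forall q : N, cdom d q ->
      nabla (metric d) X (xi d) (cmap d q) = f q *: X (cmap d q).

Definition local_expr (R : realType) (m n : nat) (M : manifold R m)
    (N : manifold R n) (i : M -> N) (c : chart R M m) (d : chart R N n) :
    'rV[R]_m -> 'rV[R]_n :=
  cmap d \o i \o cinv c.

Definition smooth_map (R : realType) (m n : nat) (M : manifold R m)
    (N : manifold R n) (i : M -> N) : Prop :=
  continuous i /\
  forall c d, atlas c -> atlas d ->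
    smooth_on (cmap c @` (cdom c `&` i @^-1` cdom d)) (local_expr i c d).

(* [M] is a submanifold of [N], with inclusion the injective immersion [i], and
   its metric is the induced one, [i^* h]. *)
Definition riemannian_submanifold (R : realType) (m n : nat)
    (M : riemannian R m) (N : riemannian R n) (i : M -> N) : Prop :=
  [/\ injective i, smooth_map i &
      forall (p : M) c d, chart_at p c -> chart_at (i p) d ->
        let J := jacobian (local_expr i c d) (cmap c p) in
        row_free J /\
        metric c (cmap c p) = J *m metric d (cmap d (i p)) *m J^T].

Definition generalized_xi_parallel (R : realType) (m n : nat)
    (M : riemannian R m) (N : riemannian R n) (i : M -> N)
    (xi : vector_field N) : Prop :=
  forall (p : M) c d, chart_at p c -> chart_at (i p) d ->
  forall W E, W `<=` cran c -> W (cmap c p) ->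
    orthonormal_frame (metric c) W E ->
    xi_tension (metric c) (metric d) (local_expr i c d) (xi d) E (cmap c p) = 0.

Definition mean_curvature_at (R : realType) (m n : nat)
    (M : riemannian R m) (N : riemannian R n) (i : M -> N)
    (p : M) (c : chart R M m) (d : chart R N n) : 'rV[R]_n :=
  mean_curvature (metric c) (metric d) (local_expr i c d) (cmap c p).

Definition mean_curvature_norm (R : realType) (m n : nat)
    (M : riemannian R m) (N : riemannian R n) (i : M -> N)
    (p : M) (c : chart R M m) (d : chart R N n) : R :=
  Num.sqrt (inner (metric d (cmap d (i p)))
    (mean_curvature_at i p c d) (mean_curvature_at i p c d)).

Definition minimal (R : realType) (m n : nat)
    (M : riemannian R m) (N : riemannian R n) (i : M -> N) : Prop :=
  forall (p : M) c d, chart_at p c -> chart_at (i p) d ->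
    mean_curvature_at i p c d = 0.

Definition cmc (R : realType) (m n : nat)
    (M : riemannian R m) (N : riemannian R n) (i : M -> N) : Prop :=
  exists k : R, forall (p : M) c d, chart_at p c -> chart_at (i p) d ->
    mean_curvature_norm i p c d = k.

Definition pseudo_umbilical (R : realType) (m n : nat)
    (M : riemannian R m) (N : riemannian R n) (i : M -> N) : Prop :=
  forall (p : M) c d, chart_at p c -> chart_at (i p) d ->
  forall a : 'rV[R]_m,
    shape_operator (metric c) (metric d) (local_expr i c d) (cmap c p)
      (mean_curvature_at i p c d) a
    = mean_curvature_norm i p c d ^+ 2 *: a.

Definition biharmonic (R : realType) (m n : nat)
    (M : riemannian R m) (N : riemannian R n) (i : M -> N) : Prop :=
  forall (p : M) c d, chart_at p c -> chart_at (i p) d ->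
  forall W E, W `<=` cran c -> W (cmap c p) ->
    orthonormal_frame (metric c) W E ->
    bitension (metric c) (metric d) (local_expr i c d) E (cmap c p) = 0.

(* Main.v *)
(** Since [sigma = f Id], the constant curvature [kappa] of [N] gives
    [grad f = - kappa xi] along [M] (from [R(X,Y) xi = X(f) Y - Y(f) X]), so that
    [tau_xi = f (kappa (m xi - 2 xi^T) + f m H)].  If it vanishes, then its
    tangential part is [kappa (m - 2) xi^T = 0], whence [f H = - kappa xi], and
    [f] is locally constant on [M].  Differentiating
    [kappa <xi, Y> = 0] along [X], for [X], [Y] tangent to [M], gives
    [<B(X,Y), H> = kappa g(X,Y)]; hence [A_H = kappa I] and [|H|^2 = kappa],
    which forces [H = 0] when [kappa <= 0].  Finally [nabla_X H = - kappa X], so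
    [Tr nabla^2 (m H) = - kappa m^2 H], which the curvature term of the
    bitension field cancels. *)

Require Import Defs.
From HB Require Import structures.
From mathcomp Require Import all_boot all_order all_algebra.
From mathcomp Require Import all_classical all_reals all_analysis.
From mathcomp Require Import ring lra.

Set Implicit Arguments.
Unset Strict Implicit.
Unset Printing Implicit Defensive.

Import Order.TTheory GRing.Theory Num.Theory.
Import numFieldNormedType.Exports.
Local Open Scope classical_set_scope.
Local Open Scope ring_scope.

(** * Smooth functions *)

Section Calculus.
Context {R : realType}.

(** Components are meaningful only on open sets of coordinates, so all identities are used as
    identities of germs; vector identities are obtained by pairing with every [w] under a positive
    definite metric. Constant sectional curvature has to be turned into a formula for the whole
    curvature tensor: minus its constant-curvature model, that tensor still has all the curvature
    symmetries, and its sectional values vanish, so polarization kills it. These symmetries, in a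
    coordinate definition, rest on Schwarz's theorem. The bound on [m] enters three times: two
    orthonormal tangent directions determine the derivative of [f] along [M], two independent
    vectors make [kappa] an actual sectional curvature, and [m - 2] is invertible. The 2 in this
    factor has two sources: one tangential part comes from tracing the curvature, the other from the
    derivative of [f]. When [kappa = 0] nothing is known about the tangential part of [xi], so the
    identities about [xi] carry the factor [kappa], and [f], which vanishes nowhere, is what gets
    divided out. *)

Lemma differentiable_bigsum (V W : normedModType R) (I : Type) (r : seq I)
    (P : pred I) (F : I -> V -> W) x :
  (forall i, P i -> differentiable (F i) x) ->
  differentiable (fun z => \sum_(i <- r | P i) F i z) x.
Proof.
move=> dF.
have -> : (fun z => \sum_(i <- r | P i) F i z) = \sum_(i <- r | P i) F i.
  by apply/funext => z; rewrite fct_sumE.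
elim/big_rec: _ => [|i f Pi df]; first exact: (@differentiable_cst _ _ _ 0).
by apply: differentiableD => //; exact: dF.
Qed.

Lemma differentiable_bigprod (V : normedModType R) (I : Type) (r : seq I)
    (P : pred I) (F : I -> V -> R) x :
  (forall i, P i -> differentiable (F i) x) ->
  differentiable (fun z => \prod_(i <- r | P i) F i z) x.
Proof.
move=> dF; elim: r => [|j r IH].
  have -> : (fun z => \prod_(i <- [::] | P i) F i z) = cst 1.
    by apply/funext => z; exact: big_nil.
  exact: differentiable_cst.
have -> : (fun z => \prod_(i <- j :: r | P i) F i z) =
    (fun z => (if P j then F j z else 1) * \prod_(i <- r | P i) F i z).
  by apply/funext => z; rewrite big_cons; case: ifP; rewrite ?mul1r.
apply: differentiableM => //; case E: (P j); first exact: dF.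
exact: differentiable_cst.
Qed.

Lemma differentiable_mxP (V : normedModType R) m n (f : V -> 'M[R]_(m, n)) x :
  differentiable f x <-> forall i j, differentiable (fun z => f z i j) x.
Proof.
split=> [df i j|df].
  have -> : (fun z => f z i j) = (fun A : 'M[R]_(m, n) => A i j) \o f by [].
  by apply: differentiable_comp => //; exact: differentiable_coord.
have -> : f = fun z => \sum_i \sum_j (f z i j *: delta_mx i j).
  by apply/funext => z; exact: matrix_sum_delta.
apply: differentiable_bigsum => i _; apply: differentiable_bigsum => j _.
exact: differentiableZl.
Qed.

Lemma derive_mxE (V : normedModType R) m n (f : V -> 'M[R]_(m, n)) x v i j :
  differentiable f x -> 'D_v f x i j = 'D_v (fun z => f z i j) x.
Proof. by move=> df; rewrite derive_mx ?mxE //; exact: diff_derivable. Qed.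


(** The little-o expansion sees only values near [x], so the expansion of [f] is one of [g], and
    uniqueness identifies the two differentials. *)
Lemma differentiable_near_eq (V W : normedModType R) (f g : V -> W) x :
  (\near x, f x = g x) -> differentiable f x -> differentiable g x.
Proof.
move=> fg df; have fgx : f x = g x by exact: nbhs_singleton fg.
have dfE := diff_locally df.
have gE : g \o shift x = cst (g x) + 'd f x +o_ 0 id.
  apply/eqaddoP => _/posnumP[e].
  have /eqaddoP /(_ e%:num) /(_ [gt0 of e%:num]) := dfE.
  have : \forall h \near 0, f (h + x) = g (h + x).
    by move: fg; rewrite (near_shift 0) subr0.
  apply: filterS2 => h /= fgh.
  by rewrite !fctE /= -fgx -fgh.
have dfc := diff_continuous df.
apply/diff_locallyP; rewrite (diff_unique dfc gE); split.
  exact: dfc.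
exact: gE.
Qed.

Lemma near_eq_open (V : topologicalType) (W : Type) (D : set V) (f g : V -> W) x :
  open D -> D x -> (forall y, D y -> f y = g y) -> \near x, f x = g x.
Proof.
move=> oD Dx fg; apply: filterS fg _; exact: open_nbhs_nbhs.
Qed.

Lemma smooth_on_subset k (W : normedModType R) (A B : set 'rV[R]_k)
    (f : 'rV[R]_k -> W) : A `<=` B -> smooth_on B f -> smooth_on A f.
Proof.
move=> AB sf l; move: (sf l); elim: l f {sf} => [|l IH] f /=.
  by move=> cf x /AB; exact: cf.
by move=> [df Df]; split=> [x /AB|v]; [exact: df|exact: IH].
Qed.

Section Ck.
Context {n : nat} (D : set 'rV[R]_n) (oD : open D).

Lemma is_Ck_continuous (W : normedModType R) k (f : 'rV[R]_n -> W) :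
  is_Ck k D f -> forall x, D x -> {for x, continuous f}.
Proof.
case: k => [|k] //= [df _] x Dx; apply: differentiable_continuous; exact: df.
Qed.

Lemma is_Ck_leS (W : normedModType R) k (f : 'rV[R]_n -> W) :
  is_Ck k.+1 D f -> is_Ck k D f.
Proof.
elim: k f => [|k IH] f; first exact: is_Ck_continuous.
by move=> [df Df]; split => // v; apply: IH; exact: Df.
Qed.

(** [is_Ck] differentiates total functions, but on an open [D] the derivatives depend only on germs.
    This allows replacing a function by a formula valid on [D] alone. *)
Lemma is_Ck_ext (W : normedModType R) k (f g : 'rV[R]_n -> W) :
  (forall x, D x -> f x = g x) -> is_Ck k D f -> is_Ck k D g.
Proof.
elim: k f g => [|k IH] f g fg.
  move=> /= cf x Dx; rewrite /prop_for /continuous_at -fg //.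
  exact: cvg_trans (near_eq_cvg (near_eq_open oD Dx fg)) (cf x Dx).
move=> [df Df]; split=> [x Dx|v].
  by apply: differentiable_near_eq (df x Dx); exact: (near_eq_open oD).
apply: IH (Df v) => x Dx; apply: near_eq_derive; exact: (near_eq_open oD).
Qed.

Lemma is_Ck_cst (W : normedModType R) k (w : W) :
  is_Ck k D (fun _ : 'rV[R]_n => w).
Proof.
elim: k w => [|k IH] w /=; first by move=> x _; exact: cst_continuous.
split=> [x _|v]; first exact: differentiable_cst.
by apply: is_Ck_ext (IH 0) => x _; rewrite derive_cst.
Qed.

Lemma is_CkD (W : normedModType R) k (f g : 'rV[R]_n -> W) :
  is_Ck k D f -> is_Ck k D g -> is_Ck k D (fun x => f x + g x).
Proof.
elim: k f g => [|k IH] f g.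
  by move=> /= cf cg x Dx; exact: continuousD (cf x Dx) (cg x Dx).
move=> [df Df] [dg Dg]; split=> [x Dx|v].
  by apply: differentiableD; [exact: df|exact: dg].
apply: is_Ck_ext (IH _ _ (Df v) (Dg v)) => x Dx.
by rewrite [RHS]deriveD //; apply: diff_derivable; [exact: df|exact: dg].
Qed.

Lemma is_CkM k (f g : 'rV[R]_n -> R) :
  is_Ck k D f -> is_Ck k D g -> is_Ck k D (fun x => f x * g x).
Proof.
elim: k f g => [|k IH] f g.
  by move=> /= cf cg x Dx; exact: continuousM (cf x Dx) (cg x Dx).
move=> Cf Cg; have [[df Df] [dg Dg]] := (Cf, Cg); split=> [x Dx|v].
  by apply: differentiableM; [exact: df|exact: dg].
(* Leibniz rule; each factor is lowered to class [k] to match the derivative of the other. *)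
apply: is_Ck_ext (is_CkD (IH _ _ (is_Ck_leS Cf) (Dg v))
  (IH _ _ (is_Ck_leS Cg) (Df v))) => x Dx.
by rewrite [RHS]deriveM //; apply: diff_derivable; [exact: df|exact: dg].
Qed.

Lemma is_Ck_sum (W : normedModType R) k (I : Type) (r : seq I) (P : pred I)
    (F : I -> 'rV[R]_n -> W) :
  (forall i, P i -> is_Ck k D (F i)) ->
  is_Ck k D (fun x => \sum_(i <- r | P i) F i x).
Proof.
move=> CF; elim: r => [|j r IH].
  by apply: is_Ck_ext (is_Ck_cst _ (0 : W)) => x _; rewrite big_nil.
have [Pj|Pj] := boolP (P j).
  by apply: is_Ck_ext (is_CkD (CF j Pj) IH) => x _; rewrite big_cons Pj.
by apply: is_Ck_ext IH => x _; rewrite big_cons (negbTE Pj).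
Qed.

Lemma is_Ck_mxP k p q (f : 'rV[R]_n -> 'M[R]_(p, q)) :
  is_Ck k D f <-> forall i j, is_Ck k D (fun x => f x i j).
Proof.
split.
  elim: k f => [|k IH] f.
    move=> /= cf i j x Dx.
    apply: (@cvg_comp _ _ _ f (fun A : 'M[R]_(p, q) => A i j)); first exact: cf.
    exact: coord_continuous.
  move=> [df Df] i j; split=> [x Dx|v].
    by have /differentiable_mxP := df x Dx; exact.
  apply: is_Ck_ext (IH _ (Df v) i j) => x Dx.
  by apply: derive_mxE; exact: df.
elim: k f => [|k IH] f Cf.
  (* Through entourages, closeness of matrices is closeness of all entries, a finite conjunction
     handled by [filter_forall]. *)
  move=> x Dx; have Fx := fmap_filter f (nbhs_filter x).
  apply/(@cvg_mx_entourageP _ _ _ (f @ x) Fx (f x)) => A entA.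
  change (\forall z \near x, forall i j, (f x i j, f z i j) \in A).
  apply: (@filter_forall _ _ (fun i z => forall j, (f x i j, f z i j) \in A)
    (nbhs x) (nbhs_filter x)) => i.
  apply: (@filter_forall _ _ (fun j z => (f x i j, f z i j) \in A)
    (nbhs x) (nbhs_filter x)) => j.
  have /cvg_entourageP /(_ A entA) := Cf i j x Dx.
  move=> /(_ (fmap_filter _ (nbhs_filter x))).
  by apply: (@filterS _ (nbhs x) (nbhs_filter x)) => z /=; rewrite inE.
have df x : D x -> differentiable f x.
  by move=> Dx; apply/differentiable_mxP => i j; case: (Cf i j) => + _; exact.
split=> // v; apply: IH => i j; apply: is_Ck_ext ((Cf i j).2 v) => x Dx.
by rewrite derive_mxE //; exact: df.
Qed.

End Ck.

End Calculus.

Section Chain.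
Context {R : realType}.

Lemma derive_comp_diff (U V W : normedModType R) (f : U -> V) (g : V -> W) x v :
  differentiable f x -> differentiable g (f x) ->
  'D_v (fun z => g (f z)) x = 'D_('d f x v) g (f x).
Proof.
move=> df dg; rewrite (@deriveE _ _ _ (g \o f)); last exact: differentiable_comp.
by rewrite diff_comp //= deriveE.
Qed.

Lemma derive_comp (U V W : normedModType R) (f : U -> V) (g : V -> W) x v :
  differentiable f x -> differentiable g (f x) ->
  'D_v (fun z => g (f z)) x = 'D_('D_v f x) g (f x).
Proof. by move=> df dg; rewrite derive_comp_diff // -deriveE. Qed.

Lemma differentiable_inv_sqrt (V : normedModType R) (s : V -> R) x :
  0 < s x -> differentiable s x -> differentiable (fun z => (Num.sqrt (s z))^-1) x.
Proof.
move=> sx ds; apply: differentiableV; last by rewrite gt_eqF // sqrtr_gt0.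
apply: (differentiable_comp ds); apply/derivable1_diffP.
by have [] := is_derive1_sqrt sx.
Qed.

(** With [r] the inverse square root of [s], differentiating [r^2 s = 1] gives
    [D_v r = - r^3 D_v s / 2], and the right-hand side is of class [k] by induction. This is the
    normalization in Gram-Schmidt. *)
Lemma is_Ck_inv_sqrt n (D : set 'rV[R]_n) (oD : open D) k (s : 'rV[R]_n -> R) :
  (forall x, D x -> 0 < s x) -> is_Ck k D s ->
  is_Ck k D (fun x => (Num.sqrt (s x))^-1).
Proof.
move=> s0; elim: k => [|k IH].
  move=> /= cs x Dx; apply: continuousV; first by rewrite gt_eqF // sqrtr_gt0 s0.
  by apply: continuous_comp; [exact: cs|exact: sqrt_continuous].
move=> Cs; have [ds Ds] := Cs; set r : _ -> R := fun x => _.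
have dr x : D x -> differentiable r x.
  by move=> Dx; apply: differentiable_inv_sqrt; [exact: s0|exact: ds].
split=> // v.
have Cr := IH (is_Ck_leS Cs).
have Cr3 := is_CkM oD (is_CkM oD (is_CkM oD Cr Cr) Cr) (Ds v).
apply: (is_Ck_ext oD _ (is_CkM oD (is_Ck_cst oD k (- 2^-1 : R)) Cr3)) => x Dx.
have rs y : D y -> r y * r y * s y = 1.
  move=> Dy; have sy := s0 _ Dy; rewrite /r -{3}(sqr_sqrtr (ltW sy)).
  by have : Num.sqrt (s y) != 0 by [rewrite gt_eqF // sqrtr_gt0 s0]; move=> h; field.
have : 'D_v (r * r * s) x = 0.
  rewrite (@near_eq_derive _ _ _ _ (cst (1 : R))) ?derive_cst //.
  exact: (near_eq_open oD).
rewrite deriveM; last 2 first.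
- by apply: derivableM; apply: diff_derivable; exact: dr.
- by apply: diff_derivable; exact: ds.
rewrite deriveM; try by apply: diff_derivable; exact: dr.
move=> h; have {}h : r x * r x * 'D_v s x
    + s x * (r x * 'D_v r x + r x * 'D_v r x) = 0.
  exact: h.
have rsx := rs x Dx.
(* Inserting the factor [r^2 s = 1] makes [r s D_v r] appear, which the differentiated relation
   determines. *)
have -> : 'D_v r x = (r x * r x * s x) * 'D_v r x by rewrite rsx mul1r.
have {}h : (r x * s x) * 'D_v r x = - 2^-1 * (r x * r x * 'D_v s x).
  have h' : r x * r x * 'D_v s x = - (2 * (s x * (r x * 'D_v r x))).
    by apply/eqP; rewrite -addr_eq0 -h; apply/eqP; ring.
  by rewrite h'; field.
transitivity (r x * (r x * s x * 'D_v r x)); last by ring.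
by rewrite h -[LHS]/(- 2^-1 * (r x * r x * r x * 'D_v s x)); ring.
Qed.

Lemma dist_common (e p q u v : R) :
  p = q -> `|u - p| < e / 2 -> `|v - q| < e / 2 -> `|v - u| <= e.
Proof.
move=> ->; rewrite !ltr_norml => /andP[? ?] /andP[? ?].
by rewrite ler_norml; apply/andP; split; lra.
Qed.

(** * Symmetry of second derivatives *)

Section Schwarz.
Context {n : nat}.

Lemma MVT_line (g : 'rV[R]_n -> R) y a t :
  0 < t -> (forall s, 0 <= s <= t -> differentiable g (y + s *: a)) ->
  exists2 s, 0 <= s <= t & g (y + t *: a) - g y = t * 'D_a g (y + s *: a).
Proof.
move=> t0 dg; pose l (s : R) := y + s *: a.
have lE : l = cst y + ( *:%R^~ a) by [].
have dl s : differentiable l s by rewrite lE; apply: differentiableD.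
have Dl s : 'D_1 l s = a.
  (* The difference quotient of the affine map [l] already equals [a] for every nonzero step. *)
  apply/lim_near_cst => //=; near=> h.
  rewrite /l /= opprD addrACA subrr add0r -scalerBl addrK /GRing.scale /= mulr1.
  rewrite -/(GRing.scale _ _) scalerA mulVf ?scale1r //.
  by near: h; exact: nbhs_dnbhs_neq.
have dgl s : 0 <= s <= t -> is_derive s 1 (g \o l) ('D_a g (l s)).
  move=> st; have dgs := dg s st; split.
    exact/diff_derivable/differentiable_comp.
  by rewrite derive_comp // Dl.
have dgl_oo s : s \in `]0, t[ -> is_derive s 1 (g \o l) ('D_a g (l s)).
  by rewrite in_itv /= => /andP[s0 st]; apply: dgl; rewrite !ltW.
have cgl : {within `[0, t], continuous (g \o l)}.
  apply: derivable_within_continuous => s; rewrite in_itv /= => st.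
  by have [] := dgl s st.
have [s st] := MVT t0 dgl_oo cgl.
rewrite /l /= scale0r addr0 subr0 => E; exists s; last by rewrite E mulrC.
by move: st; rewrite in_itv /= => /andP[s0 st]; rewrite !ltW.
Unshelve. all: by end_near. Qed.

Lemma differentiable_shift (f : 'rV[R]_n -> R) c z :
  differentiable f (z + c) -> differentiable (fun z => f (z + c)) z.
Proof. by move=> df; apply: differentiable_comp => //; exact: differentiableD. Qed.

Lemma derive_translate (f : 'rV[R]_n -> R) c z a :
  'D_a (fun z => f (z + c)) z = 'D_a f (z + c).
Proof.
rewrite /derive; have -> // : (fun h : R =>
    h^-1 *: (((fun z => f (z + c)) \o shift z) (h *: a) - f (z + c))) =
    (fun h : R => h^-1 *: ((f \o shift (z + c)) (h *: a) - f (z + c))).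
by apply/funext => h /=; rewrite addrA.
Qed.

(** The mean value theorem is applied along [a] to the increment [f (z + t *: b) - f z], then along
    [b] to ['D_a f]. The left-hand side is symmetric in [a] and [b], which is the point of the
    formula. *)
Lemma second_difference (f : 'rV[R]_n -> R) (D : set 'rV[R]_n) x a b t :
  0 < t -> is_Ck 2 D f ->
  (forall s r, 0 <= s <= t -> 0 <= r <= t -> D (x + s *: a + r *: b)) ->
  exists s r, [/\ 0 <= s <= t, 0 <= r <= t &
    f (x + t *: a + t *: b) - f (x + t *: a) - (f (x + t *: b) - f x) =
    t * (t * 'D_b ('D_a f) (x + s *: a + r *: b))].
Proof.
move=> t0 [df Df] Dt.
have t00 : 0 <= (0 : R) <= t by rewrite lexx ltW.
have tt : 0 <= t <= t by rewrite lexx ltW.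
have [|s st E] := @MVT_line (fun z => f (z + t *: b) - f z) x a t t0.
  move=> s st; apply: differentiableB; first exact/differentiable_shift/df/Dt.
  by apply: df; have := Dt s 0 st t00; rewrite scale0r addr0.
have [|r rt E2] := @MVT_line ('D_a f) (x + s *: a) b t t0.
  by move=> r rt; case: (Df a) => + _; apply; exact: Dt.
exists s, r; split => //; rewrite -E2.
rewrite [RHS](_ : _ = t * 'D_a (fun z => f (z + t *: b) - f z) (x + s *: a)).
  by rewrite -E.
rewrite deriveB ?derive_translate //; apply: diff_derivable.
  exact/differentiable_shift/df/Dt.
by apply: df; have := Dt s 0 st t00; rewrite scale0r addr0.
Qed.

(** Reading the second difference in both orders gives a value of ['D_b ('D_a f)] equal to a value
    of ['D_a ('D_b f)], at two points as close to [x] as desired; continuity concludes. *)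
Lemma derive_sym (f : 'rV[R]_n -> R) (D : set 'rV[R]_n) x a b :
  open D -> D x -> is_Ck 2 D f -> 'D_a ('D_b f) x = 'D_b ('D_a f) x.
Proof.
move=> oD Dx Cf.
apply/eqP; rewrite -subr_eq0 -normr_le0; apply/ler_addgt0Pr => e e0; rewrite add0r.
have e2 : 0 < e / 2 by rewrite divr_gt0.
have cont c d : \forall y \near x, `|'D_c ('D_d f) x - 'D_c ('D_d f) y| < e / 2.
  have : {for x, continuous ('D_c ('D_d f))} by apply: (Cf.2 d).2.
  by move=> /cvgrPdist_lt /(_ _ e2).
have : \forall y \near x, [/\ D y, `|'D_a ('D_b f) x - 'D_a ('D_b f) y| < e / 2 &
   `|'D_b ('D_a f) x - 'D_b ('D_a f) y| < e / 2].
  have : \forall y \near x, D y by exact: open_nbhs_nbhs.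
  by apply: filterS3 (cont a b) (cont b a) => y.
move=> /nbhs_normP[d /= d0 Hd].
(* Small enough for the parallelogram of sides [t *: a] and [t *: b] to lie in the ball of radius
   [d]; the 1 keeps the denominator positive. *)
pose t := d / (`|a| + `|b| + 1) / 2.
have ab0 : 0 < `|a| + `|b| + 1 by rewrite ltr_wpDl ?addr_ge0.
have t0 : 0 < t by rewrite !divr_gt0.
have near_x c c' s r : 0 <= s <= t -> 0 <= r <= t ->
    `|c| + `|c'| = `|a| + `|b| -> `|x - (x + s *: c + r *: c')| < d.
  move=> /andP[s0 st] /andP[r0 rt] cc; rewrite -addrA opprD addrA subrr sub0r normrN.
  apply: le_lt_trans (ler_normD _ _) _; rewrite !normrZ !ger0_norm //.
  apply: (@le_lt_trans _ _ (t * (`|a| + `|b|))).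
    by rewrite -cc mulrDr lerD // ler_wpM2r.
  apply: (@lt_trans _ _ (t * (`|a| + `|b| + 1))); first by rewrite ltr_pM2l // ltrDl.
  rewrite /t mulrAC -[d / _ * _]mulrA mulVf ?gt_eqF // mulr1; lra.
have [s [r [st rt E]]] := @second_difference f D x a b t t0 Cf
  (fun s r st rt => let: And3 h _ _ := Hd _ (near_x a b s r st rt erefl) in h).
have [s' [r' [st' rt' E']]] := @second_difference f D x b a t t0 Cf
  (fun s r st rt => let: And3 h _ _ := Hd _ (near_x b a s r st rt (addrC _ _)) in h).
have [_ _ H1] := Hd _ (near_x a b s r st rt erefl).
have [_ H2 _] := Hd _ (near_x b a s' r' st' rt' (addrC _ _)).
have tK (p q : R) : t * (t * p) = t * (t * q) -> p = q.
  by move=> /(mulfI (lt0r_neq0 t0)) /(mulfI (lt0r_neq0 t0)).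
refine (dist_common _ H1 H2); refine (tK _ _ (etrans (esym E) (etrans _ E'))).
(* The two second differences agree up to exchanging their middle corners. *)
by rewrite (addrAC x (t *: b)); ring.
Qed.

End Schwarz.
End Chain.

(** * Inner products *)

Section Inner.
Context {R : realType} {n : nat}.
Implicit Types (G : 'M[R]_n) (a b c : 'rV[R]_n).

Lemma innerE G a b : inner G a b = \sum_j (\sum_i a 0 i * G i j) * b 0 j.
Proof. by rewrite /inner mxE; apply: eq_bigr => j _; rewrite !mxE. Qed.

Lemma innerDl G a b c : inner G (a + b) c = inner G a c + inner G b c.
Proof. by rewrite /inner !mulmxDl mxE. Qed.
Lemma innerDr G a b c : inner G a (b + c) = inner G a b + inner G a c.
Proof. by rewrite /inner linearD mulmxDr mxE. Qed.
Lemma innerZl G k a b : inner G (k *: a) b = k * inner G a b.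
Proof. by rewrite /inner -!scalemxAl mxE. Qed.
Lemma innerZr G k a b : inner G a (k *: b) = k * inner G a b.
Proof. by rewrite /inner linearZ /= -scalemxAr mxE. Qed.
Lemma innerNl G a b : inner G (- a) b = - inner G a b.
Proof. by rewrite -scaleN1r innerZl mulN1r. Qed.
Lemma innerNr G a b : inner G a (- b) = - inner G a b.
Proof. by rewrite -scaleN1r innerZr mulN1r. Qed.
Lemma innerBl G a b c : inner G (a - b) c = inner G a c - inner G b c.
Proof. by rewrite innerDl innerNl. Qed.
Lemma innerBr G a b c : inner G a (b - c) = inner G a b - inner G a c.
Proof. by rewrite innerDr innerNr. Qed.
Lemma inner0l G b : inner G 0 b = 0.
Proof. by rewrite /inner !mul0mx mxE. Qed.
Lemma inner0r G b : inner G b 0 = 0.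
Proof. by rewrite /inner trmx0 mulmx0 mxE. Qed.
Lemma inner_suml G (I : Type) (r : seq I) (P : pred I) (F : I -> 'rV[R]_n) b :
  inner G (\sum_(i <- r | P i) F i) b = \sum_(i <- r | P i) inner G (F i) b.
Proof. by rewrite /inner !mulmx_suml summxE. Qed.

Lemma inner_tr G a b : inner G^T a b = inner G b a.
Proof.
rewrite /inner; transitivity ((a *m G^T *m b^T)^T 0 0); first by rewrite [RHS]mxE.
by rewrite !trmx_mul !trmxK mulmxA.
Qed.

Lemma innerC G a b : G^T = G -> inner G a b = inner G b a.
Proof. by move=> {1}<-; exact: inner_tr. Qed.

Lemma inner_addG G G' a b : inner (G + G') a b = inner G a b + inner G' a b.
Proof. by rewrite /inner mulmxDr mulmxDl mxE. Qed.
Lemma inner_scaleG k G a b : inner (k *: G) a b = k * inner G a b.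
Proof. by rewrite /inner -scalemxAr -scalemxAl mxE. Qed.

Definition posdef G := G^T = G /\ forall v, v != 0 -> 0 < inner G v v.

Lemma posdef_unit G : posdef G -> G \in unitmx.
Proof.
move=> [_ pG]; rewrite -row_free_unit -kermx_eq0; apply/rowV0P => v /sub_kermxP vG.
apply/eqP/contraT => /pG; rewrite /inner vG mul0mx mxE ltxx //.
Qed.

(** Take [w = a - b]. This is the way vectors defined through [sharp] are compared. *)
Lemma posdef_inj G a b : posdef G ->
  (forall w, inner G a w = inner G b w) -> a = b.
Proof.
move=> [_ pG] ab; apply/eqP; rewrite -subr_eq0; apply/contraT => /pG.
by rewrite innerBl ab subrr ltxx.
Qed.

End Inner.

Section InnerDerive.
Context {R : realType} {n : nat} {U : normedModType R}.
Variables (G : U -> 'M[R]_n) (V W : U -> 'rV[R]_n) (u : U).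
Hypotheses (dG : differentiable G u) (dV : differentiable V u)
  (dW : differentiable W u).

Lemma differentiable_inner : differentiable (fun z => inner (G z) (V z) (W z)) u.
Proof.
have /differentiable_mxP dGij := dG; have /differentiable_mxP dVi := dV.
have /differentiable_mxP dWi := dW.
rewrite (_ : (fun z => _) =
    fun z => \sum_j (\sum_i V z 0 i * G z i j) * W z 0 j); last first.
  by apply/funext => z; exact: innerE.
apply: differentiable_bigsum => j _; apply: differentiableM => //.
by apply: differentiable_bigsum => i _; apply: differentiableM.
Qed.

Lemma derive_inner v : 'D_v (fun z => inner (G z) (V z) (W z)) u =
  inner ('D_v G u) (V u) (W u) + inner (G u) ('D_v V u) (W u)
  + inner (G u) (V u) ('D_v W u).
Proof.
have dGij i j : derivable (fun z => G z i j) u v.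
  by apply: diff_derivable; exact: (differentiable_mxP _ _).1.
have dVi i : derivable (fun z => V z 0 i) u v.
  by apply: diff_derivable; exact: (differentiable_mxP _ _).1.
have dWi i : derivable (fun z => W z 0 i) u v.
  by apply: diff_derivable; exact: (differentiable_mxP _ _).1.
have -> : (fun z => inner (G z) (V z) (W z)) =
    \sum_j (\sum_i ((fun z => V z 0 i) * (fun z => G z i j))) * (fun z => W z 0 j).
  apply/funext => z; rewrite innerE fct_sumE; apply: eq_bigr => j _.
  by congr (_ * _); rewrite fct_sumE.
have dVG i j : derivable ((fun z => V z 0 i) * (fun z => G z i j)) u v.
  exact: derivableM.
have dsVG j : derivable (\sum_i ((fun z => V z 0 i) * (fun z => G z i j))) u v.
  exact: derivable_sum.
rewrite derive_sum; last by move=> j; exact: derivableM.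
rewrite !innerE -!big_split /=; apply: eq_bigr => j _.
rewrite deriveM // derive_sum // -mulrDl -big_split /= [LHS]addrC.
congr (_ + _); last by rewrite fct_sumE (derive_mxE _ _ _ dW).
rewrite [RHS]mulrC; congr (_ * _); apply: eq_bigr => i _.
by rewrite deriveM // !derive_mxE //; congr (_ + _); exact: mulrC.
Qed.
End InnerDerive.

Section InnerSmooth.
Context {R : realType} {m n : nat} (D : set 'rV[R]_m) (oD : open D) (k : nat).

Lemma is_Ck_inner (G : 'rV[R]_m -> 'M[R]_n) (V W : 'rV[R]_m -> 'rV[R]_n) :
  is_Ck k D G -> is_Ck k D V -> is_Ck k D W ->
  is_Ck k D (fun z => inner (G z) (V z) (W z)).
Proof.
move=> /(is_Ck_mxP oD) CG /(is_Ck_mxP oD) CV /(is_Ck_mxP oD) CW.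
have C : is_Ck k D (fun z => \sum_j (\sum_i V z 0 i * G z i j) * W z 0 j).
  apply: (is_Ck_sum oD) => j _; apply: (is_CkM oD) => //.
  by apply: (is_Ck_sum oD) => i _; exact: (is_CkM oD).
by apply: (is_Ck_ext oD _ C) => z _; rewrite innerE.
Qed.

Lemma is_Ck_scale (p q : nat) (s : 'rV[R]_m -> R) (F : 'rV[R]_m -> 'M[R]_(p, q)) :
  is_Ck k D s -> is_Ck k D F -> is_Ck k D (fun z => s z *: F z).
Proof.
move=> Cs /(is_Ck_mxP oD) CF; apply/(is_Ck_mxP oD) => i j.
by apply: (is_Ck_ext oD _ (is_CkM oD Cs (CF i j))) => z _; rewrite mxE.
Qed.

End InnerSmooth.

Section Scale.
Context {R : realType} {U : normedModType R} {p q : nat}.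
Variables (s : U -> R) (F : U -> 'M[R]_(p, q)) (u : U).
Hypotheses (ds : differentiable s u) (dF : differentiable F u).

Lemma differentiable_scale : differentiable (fun z => s z *: F z) u.
Proof.
apply/differentiable_mxP => i j.
rewrite (_ : (fun z => _) = s * (fun z => F z i j)); last first.
  by apply/funext => z; rewrite mxE.
by apply: differentiableM => //; exact: (differentiable_mxP _ _).1.
Qed.

Lemma derive_scale v :
  'D_v (fun z => s z *: F z) u = 'D_v s u *: F u + s u *: 'D_v F u.
Proof.
apply/matrixP => i j; rewrite derive_mxE; last exact: differentiable_scale.
rewrite (_ : (fun z => _) = s * (fun z => F z i j)); last first.
  by apply/funext => z; rewrite mxE.
rewrite deriveM; last 2 first.
- exact: diff_derivable.
- by apply: diff_derivable; exact: (differentiable_mxP _ _).1.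
by rewrite !mxE derive_mxE // addrC [_ *: 'D_v s u]mulrC.
Qed.
End Scale.

(** * Differentiability of the inverse matrix *)

Section Inverse.
Context {R : realType} {U : normedModType R}.

Lemma differentiable_det n (A : U -> 'M[R]_n) u :
  differentiable A u -> differentiable (fun z => \det (A z)) u.
Proof.
move=> /differentiable_mxP dA; apply: differentiable_bigsum => s _.
apply: differentiableM; first exact: differentiable_cst.
by apply: differentiable_bigprod => i _; exact: dA.
Qed.

(** [invmx] is defined by cases; near [u] it is given by Cramer's rule, whose entries are
    polynomials divided by a nonzero determinant. *)
Lemma differentiable_invmx n (A : U -> 'M[R]_n) u :
  differentiable A u -> (\near u, A u \in unitmx) ->
  differentiable (fun z => invmx (A z)) u.
Proof.
move=> dA Au.
apply: (@differentiable_near_eq _ _ _ (fun z => (\det (A z))^-1 *: \adj (A z))).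
  by apply: filterS Au => z Az; rewrite /invmx Az.
have Au0 : \det (A u) != 0.
  by move/nbhs_singleton : Au; rewrite unitmxE unitfE.
apply: differentiable_scale.
  by apply: differentiableV => //; exact: differentiable_det.
apply/differentiable_mxP => i j.
rewrite (_ : (fun z => _) =
    (fun z => (-1) ^+ (j + i) * \det (row' j (col' i (A z))))); last first.
  by apply/funext => z; rewrite mxE.
apply: differentiableM; first exact: differentiable_cst.
apply: differentiable_det; apply/differentiable_mxP => k l.
rewrite (_ : (fun z => _) = (fun z => A z (lift j k) (lift i l))); last first.
  by apply/funext => z; rewrite !mxE.
by move/differentiable_mxP : dA; exact.
Qed.
End Inverse.

(** * Orthonormal frames *)

Section Frame.
Context {R : realType} {m : nat} (D : set 'rV[R]_m) (oD : open D).
Variable G : 'rV[R]_m -> 'M[R]_m.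
Hypotheses (smG : smooth_on D G) (pG : forall u, D u -> posdef (G u)).

(** Gram-Schmidt on the coordinate fields. The triangularity in the last clause carries the
    induction: the earlier fields have no component of index [k], so the new vector [v] has that
    component equal to 1 and cannot vanish. *)
Lemma gram_schmidt k : (k <= m)%N -> exists e : nat -> 'rV[R]_m -> 'rV[R]_m,
  [/\ forall i, (i < k)%N -> smooth_on D (e i),
      forall u i j, D u -> (i < k)%N -> (j < k)%N ->
        inner (G u) (e i u) (e j u) = (i == j)%:R &
      forall u i (j : 'I_m), D u -> (i < k)%N -> (i < j)%N -> e i u 0 j = 0].
Proof.
elim: k => [|k IH] km; first by exists (fun _ _ => 0).
have [e [sme oe te]] := IH (ltnW km).
pose b : 'rV[R]_m := delta_mx 0 (Ordinal km).
pose v u := b + (-1) *: \sum_(j < k) (inner (G u) b (e j u) *: e j u).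
have smv : smooth_on D v.
  move=> l; apply: (is_CkD oD); first exact: is_Ck_cst.
  apply: (is_Ck_scale oD); first exact: is_Ck_cst.
  apply: (is_Ck_sum oD) => j _; apply: (is_Ck_scale oD); last exact: sme.
  by apply: (is_Ck_inner oD); [exact: smG|exact: is_Ck_cst|exact: sme].
(* Used at [j = k] for nonvanishing, and at [j > k] to preserve triangularity. *)
have vE u (j : 'I_m) : D u -> (k <= j)%N -> v u 0 j = b 0 j.
  move=> Du kj; rewrite /v !mxE summxE big1 ?mulr0 ?addr0 // => i _.
  by rewrite mxE te ?mulr0 // (leq_trans _ kj).
have v_neq0 u : D u -> v u != 0.
  move=> Du; apply/eqP => /rowP /(_ (Ordinal km)).
  by rewrite vE // !mxE !eqxx => /eqP; rewrite oner_eq0.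
have vv u : D u -> 0 < inner (G u) (v u) (v u).
  by move=> Du; case: (pG Du) => _; apply; exact: v_neq0.
have vo u j : D u -> (j < k)%N -> inner (G u) (v u) (e j u) = 0.
  move=> Du jk; rewrite /v innerDl innerZl inner_suml (bigD1 (Ordinal jk)) //=.
  rewrite innerZl oe // eqxx mulr1 big1 ?addr0 ?mulN1r ?subrr // => i ij.
  rewrite innerZl oe // (_ : (i : nat) == j = false) ?mulr0 //.
  by apply/negbTE; move: ij; rewrite -val_eqE.
pose w u := (Num.sqrt (inner (G u) (v u) (v u)))^-1 *: v u.
have smw : smooth_on D w.
  move=> l; apply: (is_Ck_scale oD) => //; apply: (is_Ck_inv_sqrt oD) => //.
  by apply: (is_Ck_inner oD).
have ww u : D u -> inner (G u) (w u) (w u) = 1.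
  move=> Du; rewrite /w innerZl innerZr mulrA -expr2 exprVn.
  by rewrite sqr_sqrtr ?mulVf ?gt_eqF ?vv // ltW ?vv.
have we u j : D u -> (j < k)%N -> inner (G u) (w u) (e j u) = 0.
  by move=> Du jk; rewrite /w innerZl vo ?mulr0.
exists (fun i => if i == k then w else e i); split.
- move=> i; rewrite ltnS leq_eqVlt; case: eqP => [//|_] /= ik; exact: sme.
- move=> u i j Du; rewrite !ltnS (leq_eqVlt i) (leq_eqVlt j).
  have sym := innerC _ _ (pG Du).1.
  case: (eqVneq i k) => [->|ik] /=; case: (eqVneq j k) => [->|jk] /=.
  + by move=> _ _; rewrite ww ?eqxx.
  + by move=> _ jltk; rewrite we // eq_sym (negbTE jk).
  + by move=> iltk _; rewrite sym we // (negbTE ik).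
  + by move=> iltk jltk; exact: oe.
- move=> u i j Du; rewrite ltnS leq_eqVlt; case: (eqVneq i k) => [->|ik] /=.
    move=> _ kj; rewrite /w mxE vE //; last exact: ltnW.
    by rewrite !mxE eqxx /= -val_eqE /= gtn_eqF ?mulr0.
  exact: te.
Qed.

(** The hypothesis on the xi-tension field quantifies over orthonormal frames; this one, defined on
    all of [D], is the frame to which it is applied. *)
Lemma orthonormal_frame_exists : exists E, orthonormal_frame G D E.
Proof.
have [e [sme oe _]] := gram_schmidt (leqnn m).
exists (fun i => e i); split => // [i|u Du i j]; first exact: sme.
by rewrite oe.
Qed.

End Frame.

(** * The Levi-Civita connection *)

(* Unification unfolds these terms when it compares them, at prohibitive cost,
   so they are generalized before any rewriting. *)
Ltac gen_analytic := repeat match goal with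
  | |- context [@derive ?R ?V ?W ?f ?x ?v] => generalize (@derive R V W f x v); intro
  | |- context [@christoffel ?R ?n ?h ?y ?a ?b] =>
      generalize (@christoffel R n h y a b); intro
  | |- context [@nabla_along ?R ?m ?n ?h ?phi ?X ?V ?u] =>
      generalize (@nabla_along R m n h phi X V u); intro
  | |- context [@nabla ?R ?n ?h ?X ?V ?y] =>
      generalize (@nabla R n h X V y); intro
  | |- context [@curvature_at ?R ?n ?h ?y ?a ?b ?c] =>
      generalize (@curvature_at R n h y a b c); intro
  | |- context [@second_form ?R ?m ?n ?g ?h ?phi ?u ?a ?b] =>
      generalize (@second_form R m n g h phi u a b); intro
  | |- context [@diff ?K ?V ?W ?F ?p ?f] => generalize (@diff K V W F p f); intro
  end.

Section Sharp.
Context {R : realType} {n : nat}.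

(** [sharpP] for a bare function: the form in [christoffel] is linear only where the metric is
    differentiable, so linearity comes as a hypothesis. *)
Lemma inner_sharp (G : 'M[R]_n) (l : 'rV[R]_n -> R) w : G \in unitmx ->
  (forall k a b, l (k *: a + b) = k * l a + l b) -> inner G (sharp G l) w = l w.
Proof.
move=> uG lin; pose lM := GRing.isLinear.Build _ _ _ _ l lin.
by pose lL : {linear _ -> _} := HB.pack l lM; exact: (@sharpP _ _ _ lL).
Qed.

Lemma sharp_inner (G : 'M[R]_n) (l : 'rV[R]_n -> R) v : posdef G ->
  (forall w, l w = inner G v w) -> sharp G l = v.
Proof.
move=> pG lE; apply: (posdef_inj pG) => w; rewrite inner_sharp ?lE //.
  exact: posdef_unit.
by move=> k a b; rewrite !lE innerDr innerZr.
Qed.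
End Sharp.

Section DeriveLinear.
Context {R : realType} {V W : normedModType R}.
Variables (f : V -> W) (x : V).
Hypothesis df : differentiable f x.

Lemma derive_linear k a b : 'D_(k *: a + b) f x = k *: 'D_a f x + 'D_b f x.
Proof. by rewrite !deriveE // linearP. Qed.
End DeriveLinear.

Lemma derive_cstE (R : realType) (V W : normedModType R) (w : W) (x a : V) :
  'D_a (fun=> w) x = 0.
Proof. exact: derive_cst. Qed.

Section Christoffel.
Context {R : realType} {n : nat} (D : set 'rV[R]_n) (oD : open D).
Variable h : 'rV[R]_n -> 'M[R]_n.
Hypotheses (smh : smooth_on D h) (ph : forall y, D y -> posdef (h y)).

Let dh y : D y -> differentiable h y.
Proof. by case: (smh 1) => + _; exact. Qed.

Let derive_h_linear y k (a b v : 'rV[R]_n) : D y -> v = k *: a + b ->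
  'D_v h y = k *: 'D_a h y + 'D_b h y.
Proof. by move=> Dy ->; exact: derive_linear (dh Dy) k a b. Qed.

Lemma derive_metric_cst y a b c : D y ->
  'D_a (fun z => inner (h z) b c) y = inner ('D_a h y) b c.
Proof.
move=> Dy; rewrite derive_inner ?derive_cstE //; first by rewrite inner0l inner0r !addr0.
exact: dh.
Qed.

Lemma derive_metricC y a b c : D y -> inner ('D_a h y) b c = inner ('D_a h y) c b.
Proof.
move=> Dy; rewrite -!derive_metric_cst //; apply: near_eq_derive.
by apply: (near_eq_open oD) => // z Dz; apply: innerC; case: (ph Dz).
Qed.

Lemma inner_christoffel y a b w : D y ->
  inner (h y) (christoffel h y a b) w =
  2^-1 * (inner ('D_a h y) b w + inner ('D_b h y) a w - inner ('D_w h y) a b).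
Proof.
move=> Dy; rewrite inner_sharp.
- by rewrite !derive_metric_cst.
- exact/posdef_unit/ph.
move=> k v1 v2; rewrite !derive_metric_cst // derive_linear; last exact: dh.
gen_analytic.
by rewrite !innerDr !innerZr inner_addG inner_scaleG; ring.
Qed.

(** Torsion-freeness: the Koszul expression is symmetric in [a] and [b]. *)
Lemma christoffelC y a b : D y -> christoffel h y a b = christoffel h y b a.
Proof.
move=> Dy; apply: (posdef_inj (ph Dy)) => w.
move: (inner_christoffel a b w Dy) (inner_christoffel b a w Dy).
move: (derive_metricC w a b Dy); gen_analytic => -> -> ->.
by rewrite [X in _ * (X - _)]addrC.
Qed.

Lemma christoffel_linear y k a a' b : D y ->
  christoffel h y (k *: a + a') b = k *: christoffel h y a b + christoffel h y a' b.
Proof.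
move=> Dy; apply: (posdef_inj (ph Dy)) => w; rewrite innerDl innerZl.
move: (inner_christoffel (k *: a + a') b w Dy).
move: (derive_h_linear Dy (erefl (k *: a + a'))).
move: (inner_christoffel a b w Dy) (inner_christoffel a' b w Dy).
gen_analytic => -> -> + -> => ->.
by rewrite inner_addG inner_scaleG !innerDl !innerZl; ring.
Qed.

Lemma christoffel0 y b : D y -> christoffel h y 0 b = 0.
Proof.
move=> Dy; have := christoffel_linear (-1) b b b Dy.
by rewrite scaleN1r addNr scaleN1r addNr.
Qed.

Lemma christoffel_linearr y k a a' b : D y ->
  christoffel h y b (k *: a + a') = k *: christoffel h y b a + christoffel h y b a'.
Proof.
move=> Dy; move: (christoffelC b (k *: a + a') Dy) (christoffelC b a Dy).
move: (christoffelC b a' Dy) (christoffel_linear k a a' b Dy).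
by gen_analytic => -> -> -> ->.
Qed.

(** Keeping zero as a variable [z] lets [christoffelZr] replace exactly the sum [k *: a + z] in the
    linearity formula. *)
Lemma christoffel0r y b z : D y -> z = 0 -> christoffel h y b z = 0.
Proof. by move=> Dy ->; rewrite christoffelC // christoffel0. Qed.

Lemma christoffelZr y k a b : D y ->
  christoffel h y b (k *: a) = k *: christoffel h y b a.
Proof.
have [z z0] : exists z : 'rV[R]_n, z = 0 by exists 0.
move=> Dy; move: (christoffel_linearr k a z b Dy) (christoffel0r b Dy z0).
have -> : k *: a + z = k *: a by rewrite z0 addr0.
by gen_analytic => -> ->; rewrite addr0.
Qed.

(** Metric compatibility: adding the Koszul formulas for [(a, b; c)] and [(a, c; b)], the
    derivatives along [b] and [c] cancel. *)
Lemma derive_metric y a b c : D y ->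
  inner ('D_a h y) b c =
  inner (h y) (christoffel h y a b) c + inner (h y) b (christoffel h y a c).
Proof.
move=> Dy; rewrite [inner (h y) b _]innerC; last by case: (ph Dy).
move: (inner_christoffel a b c Dy) (inner_christoffel a c b Dy).
by move: (derive_metricC a c b Dy); gen_analytic => + -> -> => ->; field.
Qed.

(** The symbol is a row of first derivatives of the metric times its inverse, and both are
    differentiable. Curvature differentiates the symbols once more. *)
Lemma differentiable_christoffel y a b : D y ->
  differentiable (fun z => christoffel h z a b) y.
Proof.
move=> Dy; pose l z w :=
  2^-1 * (inner ('D_a h z) b w + inner ('D_b h z) a w - inner ('D_w h z) a b).
have dD v : differentiable ('D_v h) y by case: ((smh 2).2 v) => + _; exact.
have dl w : differentiable (fun z => l z w) y.
  apply: differentiableM; first exact: differentiable_cst.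
  apply: differentiableB; first apply: differentiableD;
    by apply: differentiable_inner => //; exact: differentiable_cst.
have di : differentiable (fun z => invmx (h z)) y.
  apply: differentiable_invmx; first exact: dh.
  apply: filterS (fun z Dz => posdef_unit (ph Dz)) _; exact: open_nbhs_nbhs.
apply: (@differentiable_near_eq _ _ _
    (fun z => \row_j l z (delta_mx 0 j) *m invmx (h z))).
  apply: (near_eq_open oD) => // z Dz; congr (_ *m _); apply/rowP => j.
  rewrite !mxE /l; congr (_ * (_ + _ - _)); apply/esym; exact: derive_metric_cst.
apply/differentiable_mxP => i j.
rewrite (_ : (fun z => _) =
  (fun z => \sum_k l z (delta_mx 0 k) * invmx (h z) k j)); last first.
  by apply/funext => z; rewrite mxE; apply: eq_bigr => k _; rewrite mxE.
apply: differentiable_bigsum => k _; apply: differentiableM => //.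
exact: (differentiable_mxP _ _).1.
Qed.

(** * The connection induced along a map *)

Section Along.
Context {m : nat} (phi : 'rV[R]_m -> 'rV[R]_n) (u : 'rV[R]_m).
Hypotheses (dphi : differentiable phi u) (Dphi : D (phi u)).

Lemma nabla_along_metric (V W : 'rV[R]_m -> 'rV[R]_n) a :
  differentiable V u -> differentiable W u ->
  'D_a (fun z => inner (h (phi z)) (V z) (W z)) u =
  inner (h (phi u)) (nabla_along h phi (fun=> a) V u) (W u) +
  inner (h (phi u)) (V u) (nabla_along h phi (fun=> a) W u).
Proof.
move=> dV dW.
have dhphi : differentiable (fun z => h (phi z)) u.
  by apply: (@differentiable_comp _ _ _ _ phi h) => //; exact: dh.
have E2 : 'D_a (fun z => h (phi z)) u = 'D_('d phi u a) h (phi u).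
  by apply: derive_comp_diff => //; exact: dh.
have E1 : 'D_a (fun z => inner (h (phi z)) (V z) (W z)) u =
    inner ('D_a (fun z => h (phi z)) u) (V u) (W u)
    + inner (h (phi u)) ('D_a V u) (W u) + inner (h (phi u)) (V u) ('D_a W u).
  exact: derive_inner.
rewrite E1 E2 derive_metric // /nabla_along.
by gen_analytic; rewrite innerDl innerDr; ring.
Qed.

Lemma nabla_along_scale (s : 'rV[R]_m -> R) (V : 'rV[R]_m -> 'rV[R]_n) a :
  differentiable s u -> differentiable V u ->
  nabla_along h phi (fun=> a) (fun z => s z *: V z) u =
  'D_a s u *: V u + s u *: nabla_along h phi (fun=> a) V u.
Proof.
move=> ds dV; rewrite /nabla_along derive_scale // christoffelZr // scalerDr.
by rewrite addrA.
Qed.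

Lemma nabla_along_comp (X : 'rV[R]_n -> 'rV[R]_n) a :
  differentiable X (phi u) ->
  nabla_along h phi (fun=> a) (X \o phi) u =
  nabla h (fun=> 'd phi u a) X (phi u).
Proof.
move=> dX; exact: (congr1 (+%R^~ _) (derive_comp_diff a dphi dX)).
Qed.

Lemma nabla_along_linear (V : 'rV[R]_m -> 'rV[R]_n) k a b :
  differentiable V u ->
  nabla_along h phi (fun=> k *: a + b) V u =
  k *: nabla_along h phi (fun=> a) V u + nabla_along h phi (fun=> b) V u.
Proof.
move=> dV; rewrite /nabla_along derive_linear // linearP christoffel_linear //.
by gen_analytic; rewrite scalerDr addrACA.
Qed.

Lemma nabla_along_near (V W : 'rV[R]_m -> 'rV[R]_n) a :
  (\near u, V u = W u) ->
  nabla_along h phi (fun=> a) V u = nabla_along h phi (fun=> a) W u.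
Proof.
move=> VW; rewrite /nabla_along (near_eq_derive _ VW).
by rewrite (nbhs_singleton VW).
Qed.

End Along.

(** Makes metric compatibility of the ambient connection a special case of that of the induced
    one. *)
Lemma nabla_along_id (X V : 'rV[R]_n -> 'rV[R]_n) y :
  nabla_along h id X V y = nabla h X V y.
Proof. by rewrite /nabla_along (@diff_val _ _ _ _ _ _ _ (is_diff_id y)). Qed.

Lemma nabla_metric (V W : 'rV[R]_n -> 'rV[R]_n) y a : D y ->
  differentiable V y -> differentiable W y ->
  'D_a (fun z => inner (h z) (V z) (W z)) y =
  inner (h y) (nabla h (fun=> a) V y) (W y) +
  inner (h y) (V y) (nabla h (fun=> a) W y).
Proof.
move=> Dy dV dW; have did : differentiable id y by [].
apply: (etrans (@nabla_along_metric _ id y did Dy V W a dV dW)).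
exact: (congr2 +%R
  (congr1 (fun v => inner (h y) v (W y)) (nabla_along_id (fun=> a) V y))
  (congr1 (inner (h y) (V y)) (nabla_along_id (fun=> a) W y))).
Qed.

Lemma nabla_scale y a (s : 'rV[R]_n -> R) (V : 'rV[R]_n -> 'rV[R]_n) : D y ->
  differentiable s y -> differentiable V y ->
  nabla h (fun=> a) (fun z => s z *: V z) y =
  'D_a s y *: V y + s y *: nabla h (fun=> a) V y.
Proof.
move=> Dy ds dV; rewrite /nabla derive_scale // christoffelZr // scalerDr.
by gen_analytic; rewrite addrA.
Qed.

End Christoffel.

(** * Isometric immersions *)

Section Immersion.
Context {R : realType} {m n : nat} (D : set 'rV[R]_n) (oD : open D).
Variable h : 'rV[R]_n -> 'M[R]_n.
Hypotheses (smh : smooth_on D h) (ph : forall y, D y -> posdef (h y)).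
Context (U : set 'rV[R]_m) (oU : open U).
Variable g : 'rV[R]_m -> 'M[R]_m.
Hypotheses (smg : smooth_on U g) (pg : forall u, U u -> posdef (g u)).
Variable phi : 'rV[R]_m -> 'rV[R]_n.
Hypotheses (smphi : smooth_on U phi) (phiD : forall u, U u -> D (phi u)).
Hypothesis isom : forall u, U u -> forall a b,
  inner (g u) a b = inner (h (phi u)) ('d phi u a) ('d phi u b).

Lemma immersion_differentiable u : U u -> differentiable phi u.
Proof. by case: (smphi 1) => + _; exact. Qed.
Let dphi := immersion_differentiable.

Lemma differentiable_push u b : U u -> differentiable (fun z => 'd phi z b) u.
Proof.
move=> Uu; apply: (@differentiable_near_eq _ _ _ ('D_b phi)).
  by apply: (near_eq_open oU) => // z Uz; rewrite deriveE //; exact: dphi.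
by case: ((smphi 2).2 b) => + _; exact.
Qed.

Lemma derive_push u a b : U u -> 'D_a (fun z => 'd phi z b) u = 'D_a ('D_b phi) u.
Proof.
move=> Uu; apply: near_eq_derive; apply: (near_eq_open oU) => // z Uz.
by rewrite deriveE //; exact: dphi.
Qed.

(** Schwarz's theorem, applied to each coordinate of [phi] because it is proved for scalar
    functions. *)
Lemma derive_push_sym u a b : U u ->
  'D_a (fun z => 'd phi z b) u = 'D_b (fun z => 'd phi z a) u.
Proof.
move=> Uu; apply: (etrans (derive_push a b Uu)).
apply: (etrans _ (esym (derive_push b a Uu))).
have E v w i j : 'D_v ('D_w phi) u i j = 'D_v ('D_w (fun z => phi z i j)) u.
  apply: (@etrans _ _ ('D_v (fun z => 'D_w phi z i j) u)).
    by apply: derive_mxE; case: ((smphi 2).2 w) => + _; exact.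
  apply: near_eq_derive; apply: (near_eq_open oU) => // z Uz.
  by apply: derive_mxE; exact: dphi.
apply/matrixP => i j; apply: (etrans (E a b i j)).
apply: (etrans _ (esym (E b a i j))).
by apply: (derive_sym _ _ oU Uu); exact: ((is_Ck_mxP oU _ _).1 (smphi 2)).
Qed.

Local Notation S a b u := (nabla_along h phi (fun=> a) (fun z => 'd phi z b) u).

(** The induced connection is torsion-free and constant fields commute. *)
Lemma nabla_push_sym u a b : U u -> S a b u = S b a u.
Proof.
move=> Uu.
exact: (congr2 +%R (derive_push_sym a b Uu) (christoffelC oD smh ph _ _ (phiD Uu))).
Qed.

Lemma derive_induced u a b c : U u -> inner ('D_a g u) b c =
  inner (h (phi u)) (S a b u) ('d phi u c) + inner (h (phi u)) (S a c u) ('d phi u b).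
Proof.
move=> Uu; rewrite [X in _ + X]innerC; last by case: (ph (phiD Uu)).
apply: (etrans (esym (derive_metric_cst smg a b c Uu))).
apply: (etrans _ (nabla_along_metric oD smh ph (dphi Uu) (phiD Uu) a
  (differentiable_push b Uu) (differentiable_push c Uu))).
by apply: near_eq_derive; apply: (near_eq_open oU) => // z Uz; exact: isom.
Qed.

Lemma second_formE u a b :
  second_form g h phi u a b = S a b u - 'd phi u (christoffel g u a b).
Proof. by rewrite /second_form /nabla derive_cstE add0r. Qed.

(** This is the Gauss formula: the Koszul formula for the induced metric, each derivative of [g]
    being expanded by [derive_induced], leaves after symmetry exactly the tangential part of the
    ambient derivative. *)
Lemma second_form_normal u a b c : U u ->
  inner (h (phi u)) (second_form g h phi u a b) ('d phi u c) = 0.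
Proof.
move=> Uu; rewrite second_formE innerBl -(isom Uu (christoffel g u a b) c).
move: (inner_christoffel smg pg a b c Uu) (derive_induced a b c Uu).
move: (derive_induced b a c Uu) (derive_induced c a b Uu).
move: (nabla_push_sym b a Uu) (nabla_push_sym c a Uu) (nabla_push_sym c b Uu).
by gen_analytic => -> -> -> E1 E2 -> E3; rewrite E1 E2 E3; field.
Qed.

Lemma second_form_linear u k a a' b : U u ->
  second_form g h phi u (k *: a + a') b =
  k *: second_form g h phi u a b + second_form g h phi u a' b.
Proof.
move=> Uu; rewrite !second_formE.
have E1 : christoffel g u (k *: a + a') b =
    k *: christoffel g u a b + christoffel g u a' b.
  exact: (christoffel_linear smg pg k a a' b Uu).
have E2 : S (k *: a + a') b u = k *: S a b u + S a' b u.
  exact: (nabla_along_linear smh ph (phiD Uu) k a a' (differentiable_push b Uu)).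
move: E2 E1.
by gen_analytic => -> ->; rewrite linearP scalerBr opprD addrACA.
Qed.

Lemma second_formC u a b : U u ->
  second_form g h phi u a b = second_form g h phi u b a.
Proof.
move=> Uu; rewrite !second_formE; move: (nabla_push_sym a b Uu).
by move: (christoffelC oU smg pg a b Uu); gen_analytic => -> ->.
Qed.

Lemma second_form_linearr u k a a' b : U u ->
  second_form g h phi u b (k *: a + a') =
  k *: second_form g h phi u b a + second_form g h phi u b a'.
Proof.
move=> Uu; move: (second_formC b (k *: a + a') Uu) (second_formC b a Uu).
move: (second_formC b a' Uu) (second_form_linear k a a' b Uu).
by gen_analytic => -> -> -> ->.
Qed.

Lemma push_sum u (v : 'rV[R]_m) :
  'd phi u v = \sum_j (v 0 j *: 'd phi u (delta_mx 0 j)).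
Proof.
rewrite [in LHS](row_sum_delta v) linear_sum; apply: eq_bigr => j _.
exact: linearZ.
Qed.

Lemma differentiable_push_field u (E : 'rV[R]_m -> 'rV[R]_m) :
  U u -> differentiable E u -> differentiable (fun z => 'd phi z (E z)) u.
Proof.
move=> Uu dE; rewrite (_ : (fun z => _) =
  fun z => \sum_j (E z 0 j *: 'd phi z (delta_mx 0 j))); last first.
  by apply/funext => z; rewrite push_sum.
apply: differentiable_bigsum => j _; apply: differentiable_scale.
  exact: (differentiable_mxP _ _).1.
exact: differentiable_push.
Qed.

(** Product rule for a non-constant tangent field, obtained by expanding [E] over the coordinate
    basis. *)
Lemma derive_push_field u a (E : 'rV[R]_m -> 'rV[R]_m) :
  U u -> differentiable E u ->
  'D_a (fun z => 'd phi z (E z)) u =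
  'd phi u ('D_a E u) + 'D_a (fun z => 'd phi z (E u)) u.
Proof.
move=> Uu dE.
have D_sum (F : 'rV[R]_m -> 'rV[R]_m) : differentiable F u ->
    'D_a (fun z => 'd phi z (F z)) u =
    \sum_j ('D_a F u 0 j *: 'd phi u (delta_mx 0 j)
      + F u 0 j *: 'D_a (fun z => 'd phi z (delta_mx 0 j)) u).
  move=> dF.
  have dFj j : differentiable (fun z => F z 0 j) u.
    exact: (differentiable_mxP _ _).1.
  rewrite (_ : (fun z => _) =
    \sum_j (fun z => F z 0 j *: 'd phi z (delta_mx 0 j))); last first.
    by apply/funext => z; rewrite fct_sumE push_sum.
  rewrite derive_sum => [|j]; last first.
    apply: diff_derivable; apply: differentiable_scale => //.
    exact: differentiable_push.
  apply: eq_bigr => j _; rewrite derive_scale //; last exact: differentiable_push.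
  by rewrite derive_mxE.
have E0 : 'D_a (fun z => 'd phi z (E u)) u =
    \sum_j (E u 0 j *: 'D_a (fun z => 'd phi z (delta_mx 0 j)) u).
  apply: (etrans (D_sum (fun=> E u) _)); first exact: differentiable_cst.
  by apply: eq_bigr => j _; rewrite derive_cstE mxE scale0r add0r.
apply: (etrans (D_sum E dE)).
apply: (etrans _ (esym (congr2 +%R (push_sum u ('D_a E u)) E0))).
exact: big_split.
Qed.

(** [second_form] extends vectors by constant fields, whereas the fields of an orthonormal frame
    vary: the extra derivative of [E] is absorbed in [nabla g X E]. *)
Lemma nabla_push_field u (X E : 'rV[R]_m -> 'rV[R]_m) :
  U u -> differentiable E u ->
  nabla_along h phi X (fun z => 'd phi z (E z)) u =
  second_form g h phi u (X u) (E u) + 'd phi u (nabla g X E u).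
Proof.
move=> Uu dE.
have E1 : nabla_along h phi X (fun z => 'd phi z (E z)) u =
    'd phi u ('D_(X u) E u) + S (X u) (E u) u.
  exact: (etrans (congr1 (+%R^~ _) (derive_push_field (X u) Uu dE))
    (esym (addrA _ _ _))).
have E2 : nabla g X E u = 'D_(X u) E u + christoffel g u (X u) (E u) by [].
rewrite second_formE; move: E1 E2; gen_analytic => -> ->.
by rewrite linearD [X in _ = _ + X]addrC addrA subrK addrC.
Qed.

(** * Traces in an orthonormal frame *)

Section Trace.
Variables (W : set 'rV[R]_m) (E : 'I_m -> 'rV[R]_m -> 'rV[R]_m).
Hypothesis oE : orthonormal_frame g W E.

(** If [P] has the frame vectors as rows, orthonormality reads [P g P^T = 1], hence the inverse of
    [g] is [P^T P]. *)
Lemma frame_invmx u a b : U u -> W u -> invmx (g u) a b = \sum_i E i u 0 a * E i u 0 b.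
Proof.
move=> Uu Wu; case: oE => _ _ /(_ u Wu) oEu.
pose P := \matrix_i E i u.
have PgP : P *m (g u *m P^T) = 1%:M.
  apply/matrixP => i j; rewrite mulmxA [RHS]mxE -oEu /inner !mxE.
  apply: eq_bigr => k _; rewrite !mxE; congr (_ * _).
  by apply: eq_bigr => l _; rewrite !mxE.
have gPP : g u *m (P^T *m P) = 1%:M by rewrite mulmxA; exact: mulmx1C.
have ug := posdef_unit (pg Uu).
have -> : invmx (g u) = P^T *m P.
  by rewrite -[LHS]mulmx1 -gPP mulKmx.
by rewrite mxE; apply: eq_bigr => i _; rewrite !mxE.
Qed.

Lemma metric_trace_frame u (T : 'rV[R]_m -> 'rV[R]_m -> 'rV[R]_n) :
  U u -> W u ->
  (forall k a a' b, T (k *: a + a') b = k *: T a b + T a' b) ->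
  (forall k a a' b, T b (k *: a + a') = k *: T b a + T b a') ->
  metric_trace (g u) T = \sum_i T (E i u) (E i u).
Proof.
move=> Uu Wu linl linr.
have T0l b : T 0 b = 0.
  by have := linl (-1) 0 0 b; rewrite scaler0 addr0 scaleN1r addNr.
have T0r b : T b 0 = 0.
  by have := linr (-1) 0 0 b; rewrite scaler0 addr0 scaleN1r addNr.
have suml v b : T v b = \sum_j v 0 j *: T (delta_mx 0 j) b.
  rewrite {1}(row_sum_delta v); elim/big_rec2: _ => [|j x y _ <-]; rewrite ?T0l ?linl //.
have sumr v b : T b v = \sum_j v 0 j *: T b (delta_mx 0 j).
  rewrite {1}(row_sum_delta v); elim/big_rec2: _ => [|j x y _ <-]; rewrite ?T0r ?linr //.
rewrite /metric_trace.
transitivity (\sum_i \sum_a \sum_b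
    (E i u 0 a * E i u 0 b) *: T (delta_mx 0 a) (delta_mx 0 b)).
  rewrite [RHS]exchange_big /=; apply: eq_bigr => a _.
  rewrite [RHS]exchange_big /=; apply: eq_bigr => b _.
  by rewrite frame_invmx // scaler_suml.
apply: eq_bigr => i _; rewrite suml; apply: eq_bigr => a _.
by rewrite sumr scaler_sumr; apply: eq_bigr => b _; rewrite scalerA.
Qed.

Lemma tension_frame u : U u -> W u ->
  tension g h phi u = \sum_i second_form g h phi u (E i u) (E i u).
Proof.
move=> Uu Wu; apply: metric_trace_frame => // *.
  exact: second_form_linear.
exact: second_form_linearr.
Qed.

End Trace.

End Immersion.

(** * Curvature *)

Section CurvatureAlgebra.
Context {R : realFieldType} {V : zmodType}.
Variable T : V -> V -> V -> V -> R.
Hypotheses (skew12 : forall a b c d, T a b c d = - T b a c d)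
  (skew34 : forall a b c d, T a b c d = - T a b d c)
  (bianchi : forall a b c d, T a b c d + T b c a d + T c a b d = 0)
  (linear4 : forall a b c d d', T a b c (d + d') = T a b c d + T a b c d')
  (sect0 : forall a b, T a b b a = 0).

(** A linear combination of the four cyclic Bianchi identities, modulo skewness in each pair. *)
Lemma curvature_pair a b c d : T a b c d = T c d a b.
Proof.
have B1 := bianchi a b c d; have B2 := bianchi b c d a.
have B3 := bianchi c d a b; have B4 := bianchi d a b c.
have := skew12 c a b d; have := skew34 b c d a; have := skew34 c d b a.
have := skew12 d b c a; have := skew34 b d c a; have := skew12 d a c b.
have := skew34 a d c b; have := skew34 a c d b; have := skew12 d a b c.
have := skew34 a b d c; lra.
Qed.

(** Pair symmetry carries additivity to every slot. Polarizing [sect0] then makes [T] skew in its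
    middle arguments, so the three terms of the Bianchi identity are equal and [3 T = 0]. *)
Lemma curvature_eq0 a b c d : T a b c d = 0.
Proof.
have linear1 x x' y z w : T (x + x') y z w = T x y z w + T x' y z w.
  rewrite (curvature_pair (x + x')) (curvature_pair x) (curvature_pair x').
  by rewrite (skew34 z w (x + x')) (skew34 z w x) (skew34 z w x') linear4 opprD.
have linear2 x y y' z w : T x (y + y') z w = T x y z w + T x y' z w.
  by rewrite !(skew12 x) linear1 opprD.
have linear3 x y z z' w : T x y (z + z') w = T x y z w + T x y z' w.
  by rewrite !(curvature_pair x) linear1.
have skew23 x y z w : T x y z w = - T x z y w.
  have polar p q r : T p q q r = 0.
    have := sect0 (p + r) q; rewrite linear1 !linear4 !sect0 addr0 add0r.
    have := curvature_pair r q q p; have := skew12 q p r q; have := skew34 p q r q.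
    by lra.
  by have := polar x (y + z) w; rewrite linear2 !linear3 !polar; lra.
have := bianchi a b c d; have := skew23 b c a d; have := skew12 b a c d.
have := skew12 c a b d; have := skew23 a c b d; lra.
Qed.

End CurvatureAlgebra.

Section Curvature.
Context {R : realType} {n : nat} (D : set 'rV[R]_n) (oD : open D).
Variable h : 'rV[R]_n -> 'M[R]_n.
Hypotheses (smh : smooth_on D h) (ph : forall y, D y -> posdef (h y)).

Lemma nabla_cst z b c : nabla h (fun=> b) (fun=> c) z = christoffel h z b c.
Proof. by rewrite /nabla derive_cstE add0r. Qed.

Lemma nabla_near (X V W : 'rV[R]_n -> 'rV[R]_n) y : (\near y, V y = W y) ->
  nabla h X V y = nabla h X W y.
Proof.
by move=> VW; rewrite /nabla (near_eq_derive _ VW) (nbhs_singleton VW).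
Qed.

Lemma curvature_atE y a b c : D y ->
  curvature_at h y a b c =
  nabla h (fun=> a) (nabla h (fun=> b) (fun=> c)) y
  - nabla h (fun=> b) (nabla h (fun=> a) (fun=> c)) y.
Proof.
move=> Dy.
have lie0 : nabla h (lie (fun=> a) (fun=> b)) (fun=> c) y = 0.
  have l0 : lie (fun=> a) (fun=> b) y = 0 by rewrite /lie !derive_cstE subrr.
  by rewrite /nabla l0 derive_cstE (christoffel0 smh ph) // addr0.
by rewrite /curvature_at /curvature lie0 subr0.
Qed.

Lemma differentiable_nabla_cst y b c : D y ->
  differentiable (nabla h (fun=> b) (fun=> c)) y.
Proof.
move=> Dy; rewrite (_ : nabla h (fun=> b) (fun=> c) =
    fun z => christoffel h z b c); last by apply/funext => z; exact: nabla_cst.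
exact: (differentiable_christoffel oD smh ph).
Qed.

(* Differentiating <V, W> twice and antisymmetrizing. *)
Lemma ricci_skew (V W : 'rV[R]_n -> 'rV[R]_n) y a b : D y ->
  smooth_on D V -> smooth_on D W ->
  (forall c z, D z -> differentiable (nabla h (fun=> c) V) z) ->
  (forall c z, D z -> differentiable (nabla h (fun=> c) W) z) ->
  inner (h y) (nabla h (fun=> a) (nabla h (fun=> b) V) y
               - nabla h (fun=> b) (nabla h (fun=> a) V) y) (W y) +
  inner (h y) (V y) (nabla h (fun=> a) (nabla h (fun=> b) W) y
               - nabla h (fun=> b) (nabla h (fun=> a) W) y) = 0.
Proof.
move=> Dy smV smW dnV dnW.
have dV z : D z -> differentiable V z by case: (smV 1) => + _; exact.
have dW z : D z -> differentiable W z by case: (smW 1) => + _; exact.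
pose G z := inner (h z) (V z) (W z).
have CG : is_Ck 2 D G by apply: (is_Ck_inner oD).
have E c d : 'D_c ('D_d G) y =
    (inner (h y) (nabla h (fun=> c) (nabla h (fun=> d) V) y) (W y) +
     inner (h y) (nabla h (fun=> d) V y) (nabla h (fun=> c) W y)) +
    (inner (h y) (nabla h (fun=> c) V y) (nabla h (fun=> d) W y) +
     inner (h y) (V y) (nabla h (fun=> c) (nabla h (fun=> d) W) y)).
  have dh : differentiable h y by case: (smh 1) => + _; exact.
  pose G1 z := inner (h z) (nabla h (fun=> d) V z) (W z).
  pose G2 z := inner (h z) (V z) (nabla h (fun=> d) W z).
  have dG1 : differentiable G1 y.
    exact: (differentiable_inner dh (dnV d y Dy) (dW y Dy)).
  have dG2 : differentiable G2 y.
    exact: (differentiable_inner dh (dV y Dy) (dnW d y Dy)).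
  apply: (@etrans _ _ ('D_c (G1 + G2) y)).
    apply: near_eq_derive; apply: (near_eq_open oD) => // z Dz.
    exact: (nabla_metric oD smh ph d Dz (dV z Dz) (dW z Dz)).
  apply: (etrans (deriveD _ _)); [exact: diff_derivable|exact: diff_derivable|].
  exact: (congr2 +%R (nabla_metric oD smh ph c Dy (dnV d y Dy) (dW y Dy))
                     (nabla_metric oD smh ph c Dy (dV y Dy) (dnW d y Dy))).
have := derive_sym a b oD Dy CG.
move: (E a b) (E b a); gen_analytic => -> ->; rewrite !innerBl !innerBr.
by move=> H; apply/eqP; rewrite addrAC; move/eqP: H; rewrite -subr_eq0 => /eqP <-;
  apply/eqP; ring.
Qed.

Lemma curvature_skew12 y a b c : D y -> curvature_at h y a b c = - curvature_at h y b a c.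
Proof. by move=> Dy; rewrite !curvature_atE // opprB. Qed.

(** [ricci_skew] for two constant fields. *)
Lemma curvature_skew34 y a b c d : D y ->
  inner (h y) (curvature_at h y a b c) d = - inner (h y) (curvature_at h y a b d) c.
Proof.
move=> Dy; have sm (w : 'rV[R]_n) : smooth_on D (fun=> w) by move=> k; exact: is_Ck_cst.
have dn w e z : D z -> differentiable (nabla h (fun=> e) (fun=> w)) z.
  exact: differentiable_nabla_cst.
have := ricci_skew a b Dy (sm c) (sm d) (dn c) (dn d).
move: (curvature_atE a b c Dy) (curvature_atE a b d Dy); gen_analytic => <- <-.
by rewrite [X in _ + X]innerC; [move/eqP; rewrite addr_eq0 => /eqP|case: (ph Dy)].
Qed.

(** Torsion-freeness near [y] allows swapping the two inner arguments of each second covariant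
    derivative; the six terms then cancel in pairs. *)
Lemma curvature_bianchi y a b c : D y ->
  curvature_at h y a b c + curvature_at h y b c a + curvature_at h y c a b = 0.
Proof.
move=> Dy.
have sym p q r : nabla h (fun=> p) (nabla h (fun=> q) (fun=> r)) y =
    nabla h (fun=> p) (nabla h (fun=> r) (fun=> q)) y.
  apply: (@nabla_near _ (nabla h (fun=> q) (fun=> r)) (nabla h (fun=> r) (fun=> q))).
  apply: (near_eq_open oD Dy) => z Dz.
  apply: (etrans (nabla_cst _ _ _)); apply: (etrans _ (esym (nabla_cst _ _ _))).
  exact: (christoffelC oD smh ph).
move: (curvature_atE a b c Dy) (curvature_atE b c a Dy) (curvature_atE c a b Dy).
move: (sym a b c) (sym b c a) (sym c a b); gen_analytic => -> -> -> -> -> ->.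
by rewrite addrACA addrA; apply/matrixP => i j; rewrite !mxE; ring.
Qed.

(** Tensoriality without expanding [V]: tested against a constant [w], [ricci_skew] moves the
    commutator onto [w], where it is [curvature_at], and [curvature_skew34] moves it back. *)
Lemma ricci_identity (V : 'rV[R]_n -> 'rV[R]_n) y a b : D y ->
  smooth_on D V ->
  (forall c z, D z -> differentiable (nabla h (fun=> c) V) z) ->
  nabla h (fun=> a) (nabla h (fun=> b) V) y
  - nabla h (fun=> b) (nabla h (fun=> a) V) y = curvature_at h y a b (V y).
Proof.
move=> Dy smV dnV; apply: (posdef_inj (ph Dy)) => w.
have smw : smooth_on D (fun=> w) by move=> k; exact: is_Ck_cst.
have := ricci_skew a b Dy smV smw dnV (fun e z Dz => differentiable_nabla_cst e w Dz).
move: (curvature_skew34 a b (V y) w Dy) (curvature_atE a b w Dy).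
gen_analytic => -> ->; rewrite [X in _ + X]innerC; last by case: (ph Dy).
by move/eqP; rewrite addr_eq0 => /eqP.
Qed.

(** Pairing a linear relation with [a] and [b] gives a system whose determinant is the Gram
    determinant; Cramer's rule makes the coefficients vanish. *)
Lemma gram_row_free (H : 'M[R]_n) (a b : 'rV[R]_n) : H^T = H ->
  inner H a a * inner H b b - inner H a b ^+ 2 != 0 -> row_free (col_mx a b).
Proof.
move=> sH q0; rewrite -kermx_eq0; apply/rowV0P => x /sub_kermxP.
rewrite -[x]hsubmxK mul_row_col.
rewrite (mx11_scalar (lsubmx x)) (mx11_scalar (rsubmx x)) !mul_scalar_mx.
set s := lsubmx x 0 0; set t := rsubmx x 0 0 => E.
have Ea : s * inner H a a + t * inner H a b = 0.
  by rewrite [inner H a b]innerC // -!innerZl -innerDl E inner0l.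
have Eb : s * inner H a b + t * inner H b b = 0.
  by rewrite -!innerZl -innerDl E inner0l.
have /eqP : s * (inner H a a * inner H b b - inner H a b ^+ 2) = 0.
  transitivity ((s * inner H a a + t * inner H a b) * inner H b b
    - (s * inner H a b + t * inner H b b) * inner H a b); first by ring.
  by rewrite Ea Eb !mul0r subr0.
have /eqP : t * (inner H a a * inner H b b - inner H a b ^+ 2) = 0.
  transitivity ((s * inner H a b + t * inner H b b) * inner H a a
    - (s * inner H a a + t * inner H a b) * inner H a b); first by ring.
  by rewrite Ea Eb !mul0r subr0.
rewrite !mulf_eq0 (negbTE q0) !orbF => /eqP-> /eqP->.
by rewrite !raddf0 row_mx0.
Qed.

(** [sec] speaks only of independent pairs. For a vanishing Gram determinant both sides are zero, by
    the equality case of Cauchy-Schwarz and skewness of the curvature. *)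
Lemma sectional_num (kappa : R) y a b : D y ->
  (forall a b : 'rV[R]_n, row_free (col_mx a b) -> sectional h y a b = kappa) ->
  inner (h y) (curvature_at h y a b b) a =
  kappa * (inner (h y) a a * inner (h y) b b - inner (h y) a b ^+ 2).
Proof.
move=> Dy sec; have [sy pos] := ph Dy.
have [q0|q0] := eqVneq (inner (h y) a a * inner (h y) b b - inner (h y) a b ^+ 2) 0.
  rewrite q0 mulr0.
  have [->|b0] := eqVneq b 0.
    by rewrite (curvature_skew34 _ _ _ _ Dy) inner0r oppr0.
  have bb := pos _ b0.
  (* Its squared length is [inner (h y) b b] times the Gram determinant. *)
  have v0 : inner (h y) b b *: a - inner (h y) a b *: b = 0.
    apply/eqP/contraT => /pos; rewrite innerBl !innerBr !innerZl !innerZr.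
    rewrite (innerC b a) //; set A := inner (h y) a a in q0 *.
    set B := inner (h y) b b in q0 *; set C := inner (h y) a b in q0 *.
    suff -> : B * (B * A) - B * (C * C) - (C * (B * C) - C * (C * B)) =
      B * (A * B - C ^+ 2) by rewrite q0 mulr0 ltxx.
    by ring.
  have := curvature_skew34 a b b b Dy; move/eqP; rewrite -subr_eq0 opprK -mulr2n.
  rewrite mulrn_eq0 /= => /eqP Rb.
  apply: (mulfI (lt0r_neq0 bb)); rewrite mulr0 -innerZr.
  by move/eqP: v0; rewrite subr_eq0 => /eqP ->; rewrite innerZr Rb mulr0.
rewrite -(sec a b (gram_row_free sy q0)) /sectional divfK //.
Qed.

(* The difference with the constant curvature tensor has zero sectional curvature. *)
Lemma curvature_constant (kappa : R) y a b c : D y ->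
  (forall a b : 'rV[R]_n, row_free (col_mx a b) -> sectional h y a b = kappa) ->
  curvature_at h y a b c =
  kappa *: (inner (h y) b c *: a - inner (h y) a c *: b).
Proof.
move=> Dy sec; apply: (posdef_inj (ph Dy)) => w; have [sy _] := ph Dy.
pose T a b c d := inner (h y) (curvature_at h y a b c) d
  - kappa * (inner (h y) b c * inner (h y) a d - inner (h y) a c * inner (h y) b d).
suff : T a b c w = 0.
  move/eqP; rewrite subr_eq0; gen_analytic.
  by rewrite innerZl innerBl !innerZl => /eqP.
apply: curvature_eq0 => {a b c w}.
- move=> a b c d; move: (curvature_skew12 a b c Dy); rewrite /T.
  by gen_analytic => ->; rewrite innerNl; ring.
- move=> a b c d; move: (curvature_skew34 a b c d Dy); rewrite /T.
  by gen_analytic => ->; ring.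
- move=> a b c d; move: (curvature_bianchi a b c Dy); rewrite /T; gen_analytic.
  move=> /(congr1 (fun v => inner (h y) v d)).
  rewrite !innerDl inner0l (innerC c a) // (innerC b a) // (innerC c b) // => E.
  by rewrite -[RHS]E; ring.
- by move=> a b c d d'; rewrite /T; gen_analytic; rewrite !innerDr; ring.
- move=> a b; move: (sectional_num a b Dy sec); rewrite /T; gen_analytic => ->.
  by rewrite (innerC b a) //; ring.
Qed.

End Curvature.

(** * Generalized parallel submanifolds in charts *)

(** Here [x] stands for [xi], and [d0], [d1], [dv] for the derivatives of the concircular function
    along [t0], [t1], [v]. Pairing the first relation with [t1] gives [d0]; pairing the second with
    [t0] then gives [dv], even for [v] parallel to [t0]. *)
Lemma gradient_tangent (R : realType) n (H : 'M[R]_n) (kappa d0 d1 dv : R)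
    (x t0 t1 v : 'rV[R]_n) : H^T = H ->
  inner H t0 t0 = 1 -> inner H t0 t1 = 0 -> inner H t1 t1 = 1 ->
  d0 *: t1 - d1 *: t0 = kappa *: (inner H t1 x *: t0 - inner H t0 x *: t1) ->
  dv *: t0 - d0 *: v = kappa *: (inner H t0 x *: v - inner H v x *: t0) ->
  dv = - kappa * inner H x v.
Proof.
move=> sH t00 t01 t11 /(congr1 (fun w => inner H w t1)).
rewrite innerBl !innerZl innerBl !innerZl t01 t11 !mulr0 !mulr1 => G0.
move=> /(congr1 (fun w => inner H w t0)).
rewrite innerBl !innerZl innerBl !innerZl t00 !mulr1 (innerC x v) // => Gv.
rewrite -[LHS](subrK (d0 * inner H v t0)) Gv -[d0]subr0 G0; ring.
Qed.

Section Local.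
Context {R : realType} {m n : nat} (D : set 'rV[R]_n) (oD : open D).
Variable h : 'rV[R]_n -> 'M[R]_n.
Hypotheses (smh : smooth_on D h) (ph : forall y, D y -> posdef (h y)).
Context (U : set 'rV[R]_m) (oU : open U).
Variable g : 'rV[R]_m -> 'M[R]_m.
Hypotheses (smg : smooth_on U g) (pg : forall u, U u -> posdef (g u)).
Variable phi : 'rV[R]_m -> 'rV[R]_n.
Hypotheses (smphi : smooth_on U phi) (phiD : forall u, U u -> D (phi u)).
Hypothesis isom : forall u, U u -> forall a b,
  inner (g u) a b = inner (h (phi u)) ('d phi u a) ('d phi u b).
Variable kappa : R.
Hypothesis sec : forall y, D y -> forall a b : 'rV[R]_n, row_free (col_mx a b) ->
  sectional h y a b = kappa.
Variables (xi : 'rV[R]_n -> 'rV[R]_n) (F : 'rV[R]_n -> R).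
Hypotheses (smxi : smooth_on D xi) (smF : smooth_on D F).
Hypothesis conc : forall y, D y -> forall a, nabla h (fun=> a) xi y = F y *: a.
Hypothesis F_neq0 : forall y, D y -> F y != 0.
Hypothesis m_gt2 : (2 < m)%N.

Let dF y : D y -> differentiable F y.
Proof. by case: (smF 1) => + _; exact. Qed.

Let dxi y : D y -> differentiable xi y.
Proof. by case: (smxi 1) => + _; exact. Qed.

Let dphi := immersion_differentiable smphi.

Lemma grad_concircular y a b : D y ->
  'D_a F y *: b - 'D_b F y *: a =
  kappa *: (inner (h y) b (xi y) *: a - inner (h y) a (xi y) *: b).
Proof.
move=> Dy.
have dq (q : 'rV[R]_n) : differentiable (fun _ : 'rV[R]_n => q) y.
  exact: differentiable_cst.
(* The Christoffel term is symmetric in [p] and [q], so it drops out of the commutator. *)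
have E p q : nabla h (fun=> p) (nabla h (fun=> q) xi) y =
    'D_p F y *: q + F y *: christoffel h y p q.
  have E0 : nabla h (fun=> p) (nabla h (fun=> q) xi) y =
      nabla h (fun=> p) (fun z => F z *: q) y.
    by apply: nabla_near; apply: (near_eq_open oD Dy) => z Dz; exact: conc.
  have E1 : nabla h (fun=> p) (fun z => F z *: q) y =
      'D_p F y *: q + F y *: nabla h (fun=> p) (fun=> q) y.
    exact: (nabla_scale oD smh ph p Dy (dF Dy) (dq q)).
  apply: (etrans E0); apply: (etrans E1).
  exact: (congr1 (fun v => _ + F y *: v) (nabla_cst h y p q)).
have dnxi c z : D z -> differentiable (nabla h (fun=> c) xi) z.
  move=> Dz; apply: (@differentiable_near_eq _ _ _ (fun z => F z *: c)).
    by apply: (near_eq_open oD Dz) => x Dx; rewrite conc.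
  by apply: differentiable_scale; [exact: dF|exact: differentiable_cst].
have := ricci_identity oD smh ph a b Dy smxi dnxi.
move: (E a b) (E b a) (christoffelC oD smh ph a b Dy).
move: (curvature_constant oD smh ph a b (xi y) Dy (sec Dy)).
gen_analytic => -> -> -> -> <-.
by rewrite opprD addrACA subrr addr0.
Qed.

Lemma push_orthonormal W E u i j : orthonormal_frame g W E -> U u -> W u ->
  inner (h (phi u)) ('d phi u (E i u)) ('d phi u (E j u)) = (i == j)%:R.
Proof. by move=> [_ _ oE] Uu Wu; rewrite -isom // oE. Qed.

(** Provides a plane at the given point, so that the sign of the sectional curvatures passes to
    [kappa]. *)
Lemma independent_push u : U u -> exists a b : 'rV[R]_n, row_free (col_mx a b).
Proof.
move=> Uu; have [E oE] := orthonormal_frame_exists oU smg pg.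
pose i0 : 'I_m := Ordinal (ltn_trans (isT : 0 < 2)%N m_gt2).
pose i1 : 'I_m := Ordinal (ltn_trans (isT : 1 < 2)%N m_gt2).
exists ('d phi u (E i0 u)), ('d phi u (E i1 u)).
apply: (gram_row_free (ph (phiD Uu)).1).
rewrite (push_orthonormal i0 i0 oE Uu Uu) (push_orthonormal i1 i1 oE Uu Uu).
by rewrite (push_orthonormal i0 i1 oE Uu Uu) !eqxx mulr1 expr0n subr0 oner_neq0.
Qed.

Lemma push_grad u a : U u ->
  'D_a (fun z => F (phi z)) u = - kappa * inner (h (phi u)) (xi (phi u)) ('d phi u a).
Proof.
move=> Uu; have Dy := phiD Uu.
apply: (etrans (derive_comp_diff a (dphi Uu) (dF Dy))).
have [E oE] := orthonormal_frame_exists oU smg pg.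
pose i0 : 'I_m := Ordinal (ltn_trans (isT : 0 < 2)%N m_gt2).
pose i1 : 'I_m := Ordinal (ltn_trans (isT : 1 < 2)%N m_gt2).
exact: (gradient_tangent (ph Dy).1 (push_orthonormal i0 i0 oE Uu Uu)
  (push_orthonormal i0 i1 oE Uu Uu) (push_orthonormal i1 i1 oE Uu Uu)
  (grad_concircular ('d phi u (E i0 u)) ('d phi u (E i1 u)) Dy)
  (grad_concircular ('d phi u a) ('d phi u (E i0 u)) Dy)).
Qed.

Lemma tension_normal u c : U u ->
  inner (h (phi u)) (tension g h phi u) ('d phi u c) = 0.
Proof.
move=> Uu; rewrite /tension /metric_trace inner_suml big1 // => i _.
rewrite inner_suml big1 // => j _; rewrite innerZl.
by rewrite (second_form_normal oD smh ph oU smg pg smphi phiD isom) ?mulr0.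
Qed.

Section FrameTrace.
Variables (W : set 'rV[R]_m) (E : 'I_m -> 'rV[R]_m -> 'rV[R]_m).
Hypothesis oE : orthonormal_frame g W E.

(** By the Gauss formula, the tangential part of the derivative of a frame vector cancels the
    correction term of the trace. Used for [xi] along [phi], with [s] the concircular function, and
    for the tension field, with [s] constant. *)
Lemma trace_nabla2_push (V : 'rV[R]_m -> 'rV[R]_n) (s : 'rV[R]_m -> R) u :
  (forall X z, U z -> nabla_along h phi X V z = s z *: 'd phi z (X z)) ->
  U u -> W u -> differentiable s u ->
  trace_nabla2 g h phi E V u =
  \sum_(i < m) ('D_(E i u) s u *: 'd phi u (E i u)) + s u *: tension g h phi u.
Proof.
move=> nV Uu Wu ds.
have dE i : differentiable (E i) u by have [_ sE _] := oE; case: (sE i 1) => + _; exact.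
rewrite (tension_frame oD smh ph oU smg pg smphi phiD oE Uu Wu) scaler_sumr.
rewrite -big_split; apply: eq_bigr => i _ /=.
have dpush := differentiable_push_field oU smphi Uu (dE i).
have E1 : nabla_along h phi (E i) (nabla_along h phi (E i) V) u =
    nabla_along h phi (E i) (fun z => s z *: 'd phi z (E i z)) u.
  exact: (nabla_along_near h phi (E i u) (near_eq_open oU Uu (nV (E i)))).
have E2 : nabla_along h phi (E i) (fun z => s z *: 'd phi z (E i z)) u =
    'D_(E i u) s u *: 'd phi u (E i u)
    + s u *: nabla_along h phi (E i) (fun z => 'd phi z (E i z)) u.
  exact: (nabla_along_scale oD smh ph (phiD Uu) (E i u) ds dpush).
have E3 := nabla_push_field h oU g smphi (E i) Uu (dE i).
move: E1 E2 E3 (nV (nabla g (E i) (E i)) u Uu); gen_analytic => -> -> -> ->.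
by rewrite scalerDr addrA addrK.
Qed.

(** The factor [c] is the concircular function in the xi-tension field and 1 in the bitension
    field. *)
Lemma curvature_trace V u (c : R) : U u -> W u ->
  \sum_(i < m) curvature_at h (phi u) V (c *: 'd phi u (E i u)) ('d phi u (E i u)) =
  (c * kappa) *: (m%:R *: V
    - \sum_(i < m) (inner (h (phi u)) V ('d phi u (E i u)) *: 'd phi u (E i u))).
Proof.
move=> Uu Wu.
have mV : m%:R *: V = \sum_(i < m) V by rewrite sumr_const card_ord scaler_nat.
rewrite mV -sumrB scaler_sumr; apply: eq_bigr => i _.
apply: (etrans (curvature_constant oD smh ph V (c *: 'd phi u (E i u))
  ('d phi u (E i u)) (phiD Uu) (sec (phiD Uu)))).
move: (push_orthonormal i i oE Uu Wu); rewrite eqxx.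
generalize ('d phi u (E i u)) => t tt; rewrite innerZl tt mulr1.
by apply/matrixP => p q; rewrite !mxE; ring.
Qed.

Lemma sum_push_frame (l : 'I_m -> R) u j : U u -> W u ->
  inner (h (phi u)) (\sum_(i < m) (l i *: 'd phi u (E i u))) ('d phi u (E j u)) = l j.
Proof.
move=> Uu Wu; rewrite inner_suml (bigD1 j) //= big1 => [|i ij].
  by rewrite innerZl (push_orthonormal j j oE Uu Wu) eqxx mulr1 addr0.
by rewrite innerZl (push_orthonormal i j oE Uu Wu) (negbTE ij) mulr0.
Qed.

End FrameTrace.

Lemma nabla_along_concircular X u : U u ->
  nabla_along h phi X (xi \o phi) u = F (phi u) *: 'd phi u (X u).
Proof.
move=> Uu; have Dy := phiD Uu.
exact: (etrans (nabla_along_comp h (dphi Uu) (X u) (dxi Dy)) (conc Dy _)).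
Qed.

Lemma differentiable_F_phi u : U u -> differentiable (fun z => F (phi z)) u.
Proof.
move=> Uu; apply: (@differentiable_comp _ _ _ _ phi F); first exact: dphi.
exact: dF (phiD Uu).
Qed.

Lemma sigma_adjoint_concircular y v : D y -> sigma_adjoint h xi y v = F y *: v.
Proof.
move=> Dy; apply: (sharp_inner (ph Dy)) => a.
apply: (etrans (congr1 (inner (h y) v) (conc Dy a))).
by rewrite innerZr innerZl.
Qed.

(** The tangential part of [xi] occurs twice: once from the curvature trace, once from the
    derivative of [F] along [phi] in the trace Laplacian. The outer factor [F] comes from [sigma] in
    the first term and from its adjoint in the second. *)
Lemma xi_tension_frame (W : set 'rV[R]_m) E u : orthonormal_frame g W E ->
  U u -> W u ->
  xi_tension g h phi xi E u =
  F (phi u) *: (kappa *: (m%:R *: xi (phi u)) - (2 * kappa) *: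
    (\sum_(i < m) inner (h (phi u)) (xi (phi u)) ('d phi u (E i u))
      *: 'd phi u (E i u)) + F (phi u) *: tension g h phi u).
Proof.
move=> oE Uu Wu; have Dy := phiD Uu.
set XT := \sum_(i < m) _.
have E1 : \sum_(i < m) curvature_at h (phi u) (xi (phi u))
    (sigma h xi (phi u) ('d phi u (E i u))) ('d phi u (E i u)) =
    (F (phi u) * kappa) *: (m%:R *: xi (phi u) - XT).
  apply: (etrans _ (curvature_trace oE (xi (phi u)) (F (phi u)) Uu Wu)).
  apply: eq_bigr => i _.
  exact: (congr1 (fun v => curvature_at h (phi u) (xi (phi u)) v _) (conc Dy _)).
have E2 : trace_nabla2 g h phi E (xi \o phi) u =
    - kappa *: XT + F (phi u) *: tension g h phi u.
  apply: (etrans (trace_nabla2_push oE nabla_along_concircular Uu Wu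
    (differentiable_F_phi Uu))).
  congr (_ + _); rewrite scaler_sumr; apply: eq_bigr => i _; rewrite scalerA.
  exact: (congr1 (fun k => k *: _) (push_grad _ Uu)).
rewrite /xi_tension E1 E2 (sigma_adjoint_concircular _ Dy).
generalize (tension g h phi u) (xi (phi u)) (F (phi u)) XT => tau x f T.
by apply/matrixP => i j; rewrite !mxE; ring.
Qed.

(** * Consequences of the vanishing of the xi-tension field *)

Hypothesis parallel : forall u W E, U u -> W `<=` U -> W u ->
  orthonormal_frame g W E -> xi_tension g h phi xi E u = 0.

Let m_neq0 : m%:R != 0 :> R.
Proof. by rewrite pnatr_eq0 -lt0n (ltn_trans _ m_gt2). Qed.

Lemma tension_concircular u : U u ->
  F (phi u) *: tension g h phi u = - (kappa * m%:R) *: xi (phi u).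
Proof.
move=> Uu; have Dy := phiD Uu.
have [E oE] := orthonormal_frame_exists oU smg pg.
have := parallel Uu (@subset_refl _ U) Uu oE.
rewrite (xi_tension_frame oE Uu Uu) => /eqP.
rewrite scaler_eq0 (negbTE (F_neq0 Dy)) /= => /eqP.
pose l i := inner (h (phi u)) (xi (phi u)) ('d phi u (E i u)).
rewrite -/(\sum_(i < m) l i *: 'd phi u (E i u)) => E0.
(* Pairing with a tangent frame vector removes the normal tension field and leaves
   [kappa (m - 2) l j]. *)
have kl j : kappa * l j = 0.
  have := congr1 (fun v => inner (h (phi u)) v ('d phi u (E j u))) E0.
  rewrite inner0l !innerDl innerNl !innerZl (sum_push_frame oE l j Uu Uu).
  rewrite tension_normal // mulr0 addr0 -/(l j) => kl0.
  have m2 : m%:R - 2 != 0 :> R.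
    by rewrite subr_eq0 eqr_nat gtn_eqF.
  apply: (mulfI m2); rewrite mulr0 -[RHS]kl0.
  by generalize (l j) => x; ring.
have kXT : kappa *: (\sum_(i < m) l i *: 'd phi u (E i u)) = 0.
  by rewrite scaler_sumr big1 // => i _; rewrite scalerA kl scale0r.
move: E0; rewrite -[(2 * kappa) *: _]scalerA kXT scaler0 subr0 scalerA addrC.
by move/eqP; rewrite addr_eq0 -scaleNr => /eqP.
Qed.

(** The tension field is normal and [F] times it is [- kappa m xi]. The factor [kappa] cannot be
    cancelled in the flat case. *)
Lemma concircular_normal u b : U u ->
  kappa * inner (h (phi u)) (xi (phi u)) ('d phi u b) = 0.
Proof.
move=> Uu.
have := congr1 (fun v => inner (h (phi u)) v ('d phi u b)) (tension_concircular Uu).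
rewrite !innerZl tension_normal // mulr0 mulNr => /esym/eqP.
rewrite oppr_eq0 [kappa * _]mulrC -mulrA mulf_eq0 (negbTE m_neq0) /=.
by move/eqP.
Qed.

Lemma second_form_concircular u a b : U u ->
  kappa * inner (h (phi u)) (second_form g h phi u a b) (xi (phi u)) =
  - (kappa * F (phi u) * inner (g u) a b).
Proof.
(* In the flat case both sides vanish. Otherwise [xi] is normal on the open set [U], and this
   orthogonality can be differentiated. *)
move=> Uu; have Dy := phiD Uu; have [->|k0] := eqVneq kappa 0.
  by rewrite !mul0r oppr0.
have normal z c : U z -> inner (h (phi z)) (xi (phi z)) ('d phi z c) = 0.
  move=> Uz; apply: (mulfI k0); rewrite mulr0; exact: concircular_normal.
have dxphi : differentiable (xi \o phi) u.
  by apply: differentiable_comp; [exact: dphi|exact: dxi].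
have dpush := differentiable_push oU smphi b Uu.
have E0 : 'D_a (fun z => inner (h (phi z)) ((xi \o phi) z) ('d phi z b)) u = 0.
  apply: (etrans (near_eq_derive a (near_eq_open oU Uu
    (fun z Uz => normal z b Uz)))).
  exact: derive_cst.
have E1 : inner (h (phi u)) (nabla_along h phi (fun=> a) (xi \o phi) u) ('d phi u b)
    + inner (h (phi u)) (xi (phi u))
        (nabla_along h phi (fun=> a) (fun z => 'd phi z b) u) = 0.
  exact: (etrans (esym (nabla_along_metric oD smh ph (dphi Uu) Dy a dxphi dpush)) E0).
rewrite (isom Uu a b); move: E1 (nabla_along_concircular (fun=> a) Uu).
move: (second_formE h g phi u a b) (normal u (christoffel g u a b) Uu).
have xC v : inner (h (phi u)) v (xi (phi u)) = inner (h (phi u)) (xi (phi u)) v.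
  by apply: innerC; case: (ph Dy).
(* The second form differs from the ambient derivative by a tangent vector, orthogonal to [xi] by
   [xt3]. *)
gen_analytic => -> xt3 /eqP + E2; rewrite E2 innerZl innerBl !xC xt3 subr0.
by rewrite addrC addr_eq0 => /eqP ->; ring.
Qed.

Lemma second_form_tension u a b : U u ->
  inner (h (phi u)) (second_form g h phi u a b) (tension g h phi u) =
  kappa * m%:R * inner (g u) a b.
Proof.
move=> Uu; have Dy := phiD Uu; apply: (mulfI (F_neq0 Dy)).
have := congr1 (inner (h (phi u)) (second_form g h phi u a b)) (tension_concircular Uu).
move: (second_form_concircular a b Uu); rewrite !innerZr; gen_analytic => E ->.
by rewrite [kappa * _]mulrC -mulrN -mulrA mulNr E; ring.
Qed.

Lemma second_form_mean_curvature u a b : U u ->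
  inner (h (phi u)) (second_form g h phi u a b) (mean_curvature g h phi u) =
  kappa * inner (g u) a b.
Proof.
move=> Uu; rewrite /mean_curvature innerZr.
apply: (etrans (congr1 ( *%R m%:R^-1) (second_form_tension a b Uu))).
by rewrite [kappa * _]mulrC -mulrA mulKf.
Qed.

(** One copy of [H] is expanded as an average of [B (e_i, e_i)]; each term pairs with the other copy
    to [kappa]. *)
Lemma mean_curvature_sq u : U u ->
  inner (h (phi u)) (mean_curvature g h phi u) (mean_curvature g h phi u) = kappa.
Proof.
move=> Uu; have [E oE] := orthonormal_frame_exists oU smg pg.
have HE : mean_curvature g h phi u = m%:R^-1 *: tension g h phi u by [].
rewrite {1}HE innerZl (tension_frame oD smh ph oU smg pg smphi phiD oE Uu Uu).
rewrite inner_suml (eq_bigr (fun=> kappa)) => [|i _]; last first.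
  rewrite (second_form_mean_curvature (E i u) (E i u) Uu).
  by case: oE => _ _ ->; rewrite ?eqxx ?mulr1.
by rewrite sumr_const card_ord -[kappa *+ _]mulr_natl mulKf.
Qed.

Lemma shape_operator_mean_curvature u a : U u ->
  shape_operator g h phi u (mean_curvature g h phi u) a = kappa *: a.
Proof.
move=> Uu; apply: (sharp_inner (pg Uu)) => b.
by rewrite (second_form_mean_curvature a b Uu) innerZl.
Qed.

(** The tension field is [s] times [xi] with [s = - kappa m / F]. The derivative of [F] along [M] is
    [- kappa] times a tangential component of [xi], hence zero, so [s] has zero derivative and only
    [s F = - kappa m] remains. *)
Lemma nabla_along_tension X u : U u ->
  nabla_along h phi X (tension g h phi) u =
  - (kappa * m%:R) *: 'd phi u (X u).
Proof.
move=> Uu; have Dy := phiD Uu.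
pose s z := - (kappa * m%:R) * (F (phi z))^-1.
have ds : differentiable s u.
  apply: differentiableM; first exact: differentiable_cst.
  by apply: differentiableV; [exact: differentiable_F_phi|exact: F_neq0].
have dxphi : differentiable (xi \o phi) u.
  by apply: differentiable_comp; [exact: dphi|exact: dxi].
have Ds : 'D_(X u) s u = 0.
  have DF : 'D_(X u) (fun z => F (phi z)) u = 0.
    by rewrite (push_grad (X u) Uu) mulNr concircular_normal // oppr0.
  have dFphi := differentiable_F_phi Uu.
  apply: (etrans (deriveM _ _)).
  - exact: derivable_cst.
  - by apply: derivableV; [exact: F_neq0|exact: diff_derivable].
  rewrite deriveV //; [|exact: F_neq0|exact: diff_derivable].
  by rewrite DF derive_cst !scaler0 addr0.
have tauE z : U z -> tension g h phi z = s z *: (xi \o phi) z.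
  move=> Uz; rewrite /s mulrC -scalerA -(tension_concircular Uz) scalerA mulVf ?scale1r //.
  exact/F_neq0/phiD.
apply: (etrans (nabla_along_near h phi (X u) (near_eq_open oU Uu tauE))).
apply: (etrans (nabla_along_scale oD smh ph Dy (X u) ds dxphi)).
rewrite Ds scale0r add0r.
apply: (etrans (congr1 ( *:%R (s u)) (nabla_along_concircular (fun=> X u) Uu))).
by rewrite scalerA /s mulfVK // F_neq0.
Qed.

Lemma bitension_eq0 (W : set 'rV[R]_m) E u : orthonormal_frame g W E ->
  U u -> W u -> bitension g h phi E u = 0.
Proof.
move=> oE Uu Wu.
have E1 : \sum_(i < m) curvature_at h (phi u) (tension g h phi u)
    ('d phi u (E i u)) ('d phi u (E i u)) = (kappa * m%:R) *: tension g h phi u.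
  have := curvature_trace oE (tension g h phi u) 1 Uu Wu.
  rewrite mul1r [X in _ - X]big1 => [|i _]; last by rewrite tension_normal // scale0r.
  rewrite subr0 scalerA => <-; apply: eq_bigr => i _.
  by generalize ('d phi u (E i u)) => t; rewrite scale1r.
have E2 : trace_nabla2 g h phi E (tension g h phi) u =
    - (kappa * m%:R) *: tension g h phi u.
  apply: (etrans (trace_nabla2_push oE (s := fun=> - (kappa * m%:R))
    nabla_along_tension Uu Wu (differentiable_cst _ _))).
  by rewrite big1 ?add0r // => i _; rewrite derive_cstE scale0r.
by rewrite /bitension E1 E2 scaleNr addrN.
Qed.

Lemma mean_curvature_nonpositive u : U u -> kappa <= 0 -> mean_curvature g h phi u = 0.
Proof.
move=> Uu k0; apply/eqP/contraT => /(ph (phiD Uu)).2.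
by rewrite mean_curvature_sq // ltNge k0.
Qed.

End Local.

(** * From charts to manifolds *)

Lemma metric_posdef (R : realType) n (N : riemannian R n) (d : chart R N n) y :
  atlas d -> cran d y -> posdef (metric d y).
Proof.
by move=> ad dy; split;
  [exact: (Defs.metric_sym ad dy)|exact: (Defs.metric_pos ad dy)].
Qed.

Section Charts.
Context {R : realType} {m n : nat} (M : riemannian R m) (N : riemannian R n).
Variable i : M -> N.
Hypothesis sub : riemannian_submanifold i.
Variables (c : chart R M m) (d : chart R N n).
Hypotheses (ac : atlas c) (ad : atlas d).

(** The set on which [local_expr i c d] has a meaning; it plays the role of [U] in the local
    results. *)
Definition chart_overlap := cmap c @` (cdom c `&` i @^-1` cdom d).

Lemma chart_overlap_open : open chart_overlap.
Proof.
have [_ [ci _] _] := sub.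
have oA : open (cdom c `&` i @^-1` cdom d).
  apply: openI; first exact: cdom_open.
  by apply: open_comp (@cdom_open _ _ _ d) => p _; exact: ci.
rewrite openE => _ [p [cp dp] <-].
have crp : cran c (cmap c p) by exists p.
(* [cinv c] is a total function, so its preimage is intersected with [cran c], where it inverts
   [cmap c]. *)
have nA : nbhs (cmap c p) (cinv c @^-1` (cdom c `&` i @^-1` cdom d)).
  apply: (cinv_continuous crp); rewrite cmapK //.
  by apply: open_nbhs_nbhs; split.
have nC : nbhs (cmap c p) (cran c) by apply: open_nbhs_nbhs; split => //; exact: cran_open.
apply: filterS (filterI nA nC) => z [/= Az [q cq qz]].
by exists q => //; rewrite -qz cmapK in Az.
Qed.

Lemma chart_overlap_cran u : chart_overlap u -> cran c u.
Proof. by move=> [p [cp _] <-]; exists p. Qed.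

Lemma local_expr_cmap p : cdom c p -> local_expr i c d (cmap c p) = cmap d (i p).
Proof. by move=> cp; rewrite /local_expr /= cmapK. Qed.

Lemma local_expr_cran u : chart_overlap u -> cran d (local_expr i c d u).
Proof. by move=> [p [cp dp] <-]; rewrite local_expr_cmap //; exists (i p). Qed.

Lemma induced_metric u a b : chart_overlap u ->
  inner (metric c u) a b =
  inner (metric d (local_expr i c d u))
    ('d (local_expr i c d) u a) ('d (local_expr i c d) u b).
Proof.
move=> [p [cp dp] <-]; have [_ _ /(_ p c d (conj ac cp) (conj ad dp))[_ ->]] := sub.
rewrite local_expr_cmap // /inner -!mul_rV_lin1 -/(jacobian _ _).
by rewrite trmx_mul !mulmxA.
Qed.

End Charts.

Section Global.
Context {R : realType} {m n : nat} (M : riemannian R m) (N : riemannian R n).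
Variables (i : M -> N) (xi : vector_field N) (f : N -> R) (kappa : R).
Hypotheses (m_gt2 : (2 < m)%N) (sub : riemannian_submanifold i).
Hypothesis sec : forall (q : N) d, chart_at q d ->
  forall a b : 'rV[R]_n, row_free (col_mx a b) ->
  sectional (metric d) (cmap d q) a b = kappa.
Hypotheses (conc : concircular xi f) (f_neq0 : forall q : N, f q != 0).
Hypothesis parallel : generalized_xi_parallel i xi.

(** [kappa] is the same for all pairs of charts, so these pointwise conclusions give a global
    constant for the length of [H]. *)
Lemma local_theorem (p : M) c d : chart_at p c -> chart_at (i p) d ->
  [/\ exists a b : 'rV[R]_n, row_free (col_mx a b),
      inner (metric d (cmap d (i p))) (mean_curvature_at i p c d)
        (mean_curvature_at i p c d) = kappa,
      forall a, shape_operator (metric c) (metric d) (local_expr i c d) (cmap c p)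
        (mean_curvature_at i p c d) a = kappa *: a,
      forall W E, W (cmap c p) -> orthonormal_frame (metric c) W E ->
        bitension (metric c) (metric d) (local_expr i c d) E (cmap c p) = 0 &
      kappa <= 0 -> mean_curvature_at i p c d = 0].
Proof.
move=> [ac cp] [ad dp].
have Uu : chart_overlap i c d (cmap c p) by exists p.
have oU : open (chart_overlap i c d) by exact: chart_overlap_open.
have smh : smooth_on (cran d) (metric d) by exact: metric_smooth.
have oD : open (cran d) by exact: cran_open.
have ph y : cran d y -> posdef (metric d y) by exact: metric_posdef.
have smg : smooth_on (chart_overlap i c d) (metric c).
  by apply: smooth_on_subset (metric_smooth ac); exact: chart_overlap_cran.
have pg u : chart_overlap i c d u -> posdef (metric c u).
  by move=> /chart_overlap_cran; exact: metric_posdef.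
have smphi : smooth_on (chart_overlap i c d) (local_expr i c d).
  by have [_ [_ sm] _] := sub; exact: sm.
have phiD := @local_expr_cran _ _ _ M N i c d.
have isom u (Uu' : chart_overlap i c d u) a b := induced_metric sub ac ad a b Uu'.
have secD y : cran d y -> forall a b : 'rV[R]_n, row_free (col_mx a b) ->
    sectional (metric d) y a b = kappa.
  by move=> [q dq <-]; exact: sec (conj ad dq).
have smxi : smooth_on (cran d) (xi d) by exact: vf_smooth.
have smF : smooth_on (cran d) (f \o cinv d : 'rV[R]_n -> R) by exact: conc.1.
have concD y : cran d y -> forall a,
    nabla (metric d) (fun=> a) (xi d) y = (f \o cinv d) y *: a.
  move=> [q dq <-] a; rewrite /= cmapK //.
  apply: (conc.2 d (fun=> a) ad _ q dq) => k.
  exact: is_Ck_cst.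
have F0 y : cran d y -> (f \o cinv d) y != 0 by move=> _; exact: f_neq0.
have par u W E : chart_overlap i c d u -> W `<=` chart_overlap i c d -> W u ->
    orthonormal_frame (metric c) W E ->
    xi_tension (metric c) (metric d) (local_expr i c d) (xi d) E u = 0.
  move=> [q [cq dq] <-] WU Wq oE.
  apply: (parallel (conj ac cq) (conj ad dq) _ Wq oE) => z /WU.
  exact: chart_overlap_cran.
split.
- exact: (independent_push ph oU smg pg phiD isom m_gt2 Uu).
- rewrite -(local_expr_cmap i d cp).
  exact: (mean_curvature_sq oD smh ph oU smg pg smphi phiD isom secD smxi smF concD
    F0 m_gt2 par Uu).
- move=> a.
  exact: (shape_operator_mean_curvature oD smh ph oU smg pg smphi phiD isom secD
    smxi smF concD F0 m_gt2 par a Uu).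
- move=> W E Wu oE.
  exact: (bitension_eq0 oD smh ph oU smg pg smphi phiD isom secD
    smxi smF concD F0 m_gt2 par oE Uu Wu).
- exact: (mean_curvature_nonpositive oD smh ph oU smg pg smphi phiD isom secD
    smxi smF concD F0 m_gt2 par Uu).
Qed.

End Global.

Theorem theorem14 (R : realType) (m n : nat)
    (M : riemannian R m) (N : riemannian R n) (i : M -> N)
    (xi : vector_field N) (f : N -> R) :
  (2 < m)%N ->
  space_form N ->
  riemannian_submanifold i ->
  concircular xi f ->
  (forall q : N, f q != 0) ->
  generalized_xi_parallel i xi ->
  (cmc i /\ pseudo_umbilical i /\ biharmonic i) /\
  (nonpositive_sectional N -> minimal i).
Proof.
move=> m_gt2 [kappa sec] sub conc f_neq0 par.
have loc := local_theorem m_gt2 sub sec conc f_neq0 par.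
split; [split; [|split]|].
- exists (Num.sqrt kappa) => p c d cp dp; rewrite /mean_curvature_norm.
  by have [_ -> _ _ _] := loc p c d cp dp.
- move=> p c d cp dp a; have [_ HH sh _ _] := loc p c d cp dp.
  (* Squaring the square root returns [kappa] because [kappa] is nonnegative, being the squared
     length of the mean curvature vector. *)
  rewrite sh /mean_curvature_norm HH sqr_sqrtr // -HH.
  have [H0|H0] := eqVneq (mean_curvature_at i p c d) 0; first by rewrite H0 inner0l.
  apply/ltW/Defs.metric_pos => //; first by case: dp.
  by case: dp => _ dp; exists (i p).
- by move=> p c d cp dp W E _ Wu oE; have [_ _ _ bi _] := loc p c d cp dp; exact: (bi W E).
- move=> nonpos p c d cp dp; have [[a [b ab]] _ _ _ min] := loc p c d cp dp.
  by apply: min; rewrite -(sec _ _ dp a b ab); exact: nonpos.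
Qed.
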